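(* The success-number function has the formula $$\lambda_U(i)=U\sum_{j=1}^{i}\int_{\frac{1}{k}}^{1}t\cdot a(t)\binom{U-1}{j-1}(\mathbb{E}[v_t])^{U-j}(1-\mathbb{E}[v_t])^{j-1}\,dt,$$ where $$v_t(x)=\begin{cases}x, & x\ge t\\ 1, & x<t,\end{cases}\qquad \mathbb{E}[v_t]=\int_0^t a(x)\,dx+\int_t^1 x\, a(x)\,dx.$$
   Context: Honeyword system with $U$ users. Each user's sweetword list is generated independently: one real password sampled from a distribution $P$ and $k-1$ honeywords sampled i.i.d. from a distribution $Q$, then randomly shuffled. The attacker gets only one guess per account ($T_1=1$). In the success-number game with parameter $t$, an attacker $\mathcal{A}$ (any probabilistic Turing machine) receives all $U$ sweetword lists and outputs $U$ guesses $(x,pw^* )$ with distinct user indices $x\in\{1,\dots,U\}$; the guesses are checked in order, the success number increases by one if $pw^*$ is the password of user $x$ and the failure number increases by one otherwise, and the game outputs the success number when the failure number reaches $t$, or after all $U$ guesses are checked. $\lambda_U(t)$ is the maximum over attackers $\mathcal{A}$ of the expected output of this game. For user $i$ with sweetwords $sw_{i1},\dots,sw_{ik}$, let $w_i=\max_{1\le m\le k}\frac{P(sw_{im})/Q(sw_{im})}{\sum_{j=1}^{k}P(sw_{ij})/Q(sw_{ij})}$, the success probability of the optimal single guess on that account; $w$ is a random variable (randomness from generating the sweetword list) with probability density $a(t)$, $0\le t\le 1$. *)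

(* Defs.v *)
From HB Require Import structures.
From mathcomp Require Import all_boot all_order all_algebra.
From mathcomp Require Import all_classical all_reals all_analysis.
From mathcomp Require Import perm.
Set Implicit Arguments. Unset Strict Implicit. Unset Printing Implicit Defensive.
Import Order.TTheory GRing.Theory Num.Theory.
Local Open Scope classical_set_scope.
Local Open Scope ring_scope.

(* Success-number game (parameter t) on the sequence of outcomes of the
   guesses, checked in order (true = success, false = failure).
   The game stops and outputs the success number as soon as the failure
   number reaches t, or after all guesses are checked.                   *)
Fixpoint game (t : nat) (s : seq bool) : nat :=
  match s with
  | [::] => 0%N
  | b :: s' =>
      if t is t'.+1 then (if b then (game t s').+1 else game t' s')
      else 0%N
  end.

(* An attacker's output: U guesses with distinct user indices, i.e. an
   ordering of the users (guess number n is on user (o.1 n)) together with,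
   for each user, the index of the sweetword guessed for that user.       *)
Definition guesses (U k : nat) : finType :=
  prod {perm 'I_U} {ffun 'I_U -> 'I_k}.

Definition sweetdata (T : Type) (U k : nat) := 'I_U -> 'I_k -> T.

Definition cylinders d (T : measurableType d) (U k : nat)
  : set (set (sweetdata T U k)) :=
  [set C | exists (u : 'I_U) (m : 'I_k) (S : set T),
      measurable S /\ C = [set x | S (x u m)]].

(* A (probabilistic) attacker is a Markov kernel from the sweetword data
   to the finite set of possible outputs: A x o is the probability that,
   on input x, the attacker outputs o.  It must be measurable w.r.t. the
   product sigma-algebra of the data.                                    *)
Definition attacker d (T : measurableType d) (R : realType) (U k : nat)
  (A : sweetdata T U k -> guesses U k -> R) : Prop :=
  [/\ forall x o, 0 <= A x o,
      forall x, \sum_(o : guesses U k) A x o = 1 &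
      forall o (B : set R), measurable B ->
        <<s @cylinders d T U k >> [set x | B (A x o)] ].

(* The sweetword list of user u: the real password real u sits at the
   (uniformly random) position pos u, the other positions hold honeywords. *)
Definition sweet d (T : measurableType d) (Omega : Type) (U k : nat)
  (real : 'I_U -> Omega -> T) (hon : 'I_U -> 'I_k -> Omega -> T)
  (pos : 'I_U -> Omega -> 'I_k) (w : Omega) : sweetdata T U k :=
  fun u m => if m == pos u w then real u w else hon u m w.

Definition outcomes (Omega : Type) (U k : nat) (pos : 'I_U -> Omega -> 'I_k)
  (o : guesses U k) (w : Omega) : seq bool :=
  [seq (o.2 (o.1 n) == pos (o.1 n) w) | n <- enum 'I_U].

Definition expected_success d (T : measurableType d) (R : realType)
  dO (Omega : measurableType dO) (Pr : probability Omega R) (U k : nat)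
  (real : 'I_U -> Omega -> T) (hon : 'I_U -> 'I_k -> Omega -> T)
  (pos : 'I_U -> Omega -> 'I_k)
  (A : sweetdata T U k -> guesses U k -> R) (t : nat) : \bar R :=
  (\int[Pr]_(w in setT)
     (\sum_(o : guesses U k)
        A (sweet real hon pos w) o * (game t (outcomes pos o w))%:R)%:E)%E.

(* w for a sweetword list sw, with r = P/Q:
   max_m (r(sw_m) / sum_j r(sw_j)). *)
Definition wval (R : realType) (T : Type) (k : nat) (r : T -> R)
  (sw : 'I_k -> T) : R :=
  \big[Num.max/0]_(m < k) (r (sw m) / \sum_(j < k) r (sw j)).

Definition Ev (R : realType) (a : R -> R) (t : R) : R :=
  let I1 : set R := [set x : R | 0 <= x < t] in
  let I2 : set R := `[t, 1]%classic in
  fine ((\int[lebesgue_measure]_(x in I1) (a x)%:E) +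
        (\int[lebesgue_measure]_(x in I2) (x * a x)%:E))%E.

Definition lambda_formula (R : realType) (a : R -> R) (U k i : nat) : \bar R :=
  let I : set R := `[(k%:R)^-1, 1]%classic in
  ((U%:R)%:E *
   \sum_(1 <= j < i.+1)
     \int[lebesgue_measure]_(t in I)
        (t * a t * ('C(U - 1, j - 1))%:R * Ev a t ^+ (U - j)
           * (1 - Ev a t) ^+ (j - 1))%:E)%E.

(* Main.v *)
(** Given the sweetword lists, the positions of the real passwords are
    independent and the one of user [u] has the posterior law proportional to
    [r = P/Q] on the list.  This is a density statement with respect to the
    i.i.d. product of [Q], which is realised by the honeywords themselves: one
    is drawn at every position, including the one that the password overwrites.

    Hence the expected output of a list of guesses is the mean [mean_game] of
    the game over independent Bernoulli outcomes.  It is monotone in each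
    success probability, and exchanging two adjacent guesses shows that it is
    maximal when the probabilities are decreasing; so the optimal attacker
    guesses a best sweetword of each user and sorts the users by [w].

    A guess of value [t] on user [u] then counts iff it succeeds and fewer than
    [i] of the guesses on users ranked before [u] have failed.  Another user is
    ranked before and does not fail, or is ranked after, with probability
    [E v_t], independently of the others, so the number of these failures is
    binomial.  Integrating against the law of [w_u], by resampling the list of
    [u] independently, and summing over [u] gives the formula. *)

Require Import Defs.
From HB Require Import structures.
From mathcomp Require Import all_boot all_order all_algebra.
From mathcomp Require Import all_classical all_reals all_analysis.
From mathcomp Require Import perm measurable_realfun ring lra.
Import Order.TTheory GRing.Theory Num.Theory.
Local Open Scope classical_set_scope.
Local Open Scope ring_scope.

Set Implicit Arguments. Unset Strict Implicit. Unset Printing Implicit Defensive.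

Lemma sume_cst_ord (R : realType) (n : nat) (x : \bar R) :
  (\sum_(j < n) x = n%:R%:E * x)%E.
Proof.
rewrite mule_natl; elim: n => [|n IH]; first by rewrite big_ord0 mule0n.
by rewrite big_ord_recl muleS IH.
Qed.

Lemma map_cst_nseq (A B : Type) (s : seq A) (b : B) :
  [seq b | _ <- s] = nseq (size s) b.
Proof. by elim: s => //= x s ->. Qed.

(** * Expected output of the game over independent outcomes *)

Section success_number.
Context {R : realType}.
Implicit Types (t : nat) (p q : R) (s : seq R).

Fixpoint mean_game t s : R :=
  match s with
  | [::] => 0
  | p :: s' =>
      if t is t'.+1 then p * (1 + mean_game t s') + (1 - p) * mean_game t' s'
      else 0
  end.

(** A Poisson binomial distribution function: the probability that fewer than [t] of independent
    trials fail, when they succeed with the probabilities in [s]. *)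
Fixpoint few_failures t s : R :=
  match s with
  | [::] => (0 < t)%N%:R
  | p :: s' =>
      if t is t'.+1 then p * few_failures t s' + (1 - p) * few_failures t' s'
      else 0
  end.

Definition is_prob p := (0 <= p) && (p <= 1).

Lemma mean_game0 s : mean_game 0 s = 0. Proof. by case: s. Qed.

Lemma few_failures0 s : few_failures 0 s = 0. Proof. by case: s. Qed.

Lemma few_failures_01 t s : all is_prob s -> 0 <= few_failures t s <= 1.
Proof.
elim: s t => [t _|p s IH [|t]] /=; first by case: t => [|t]; rewrite /= ?lexx ler01.
  by rewrite lexx ler01.
move=> /andP[/andP[p0 p1] hs]; have := IH t hs; have := IH t.+1 hs.
by move=> /andP[? ?] /andP[? ?]; apply/andP; split; nra.
Qed.

(** The two claims are proved together because the induction step of the second at [t = 0] uses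
    nonnegativity for the tail with one failure allowed. *)
Lemma mean_game_nondecreasing t s : all is_prob s ->
  0 <= mean_game t s /\ mean_game t s <= mean_game t.+1 s.
Proof.
elim: s t => [//|p s IH t] /= /andP[/andP[p0 p1] hs].
case: t => [|t].
  by have [h0 _] := IH 1%N hs; rewrite mean_game0; split => //; nra.
have [h0 h1] := IH t hs; have [h2 h3] := IH t.+1 hs.
by split; nra.
Qed.

Lemma mean_game_ge0 t s : all is_prob s -> 0 <= mean_game t s.
Proof. by case/(mean_game_nondecreasing t). Qed.

(** A success adds 1 and leaves a larger failure budget for the tail than a failure does, and the
    tail is nondecreasing in that budget. *)
Lemma mean_game_cons_le t p q s s' : is_prob p -> is_prob q -> all is_prob s ->
  p <= q -> (forall t', mean_game t' s <= mean_game t' s') ->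
  mean_game t (p :: s) <= mean_game t (q :: s').
Proof.
move=> /andP[p0 p1] /andP[q0 q1] hs pq hss; case: t => [//|t] /=.
have [h0 h1] := mean_game_nondecreasing t hs.
have := hss t; have := hss t.+1 => h2 h3.
(* First [p] is raised to [q] with the tail [s] kept; then [s] is replaced by [s']. *)
apply: (@le_trans _ _ (q * (1 + mean_game t.+1 s) + (1 - q) * mean_game t s)).
  by nra.
by nra.
Qed.

Lemma mean_game_mono (I : Type) t (l : seq I) (f g : I -> R) :
  (forall u, is_prob (f u)) -> (forall u, is_prob (g u)) ->
  (forall u, f u <= g u) -> mean_game t (map f l) <= mean_game t (map g l).
Proof.
move=> hf hg fg; elim: l t => [//|u l IH] t.
apply: mean_game_cons_le => //.
by elim: l {IH} => //= x l ->; rewrite hf.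
Qed.

(** With one failure left the second guess is reached only after a success of the first, and the two
    orders differ by [q - p]. With at least two failures left both guesses are always checked, and
    the two values are equal. *)
Lemma mean_game_swap t p q s : p <= q ->
  mean_game t [:: p, q & s] <= mean_game t [:: q, p & s].
Proof.
move=> pq; case: t => [//|[|t]] /=.
  by rewrite !mean_game0; nra.
set a := mean_game _ s; set b := mean_game _ s; set c := mean_game _ s.
by rewrite le_eqVlt; apply/orP; left; apply/eqP; ring.
Qed.

Lemma mean_game_to_front t q s1 s2 : is_prob q -> all is_prob (s1 ++ s2) ->
  all (fun p => p <= q) s1 ->
  mean_game t (s1 ++ q :: s2) <= mean_game t (q :: s1 ++ s2).
Proof.
move=> hq; elim: s1 t => [//|p s1 IH] t /= /andP[hp hs] /andP[pq h1].
apply: le_trans (mean_game_swap t (s1 ++ s2) pq).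
apply: mean_game_cons_le => //; last by move=> t'; exact: IH.
by move: hs; rewrite !all_cat /= hq.
Qed.

(** As in selection sort, the head of [s'] is a maximum of [s] and is brought to the front, which
    does not decrease the value; the induction hypothesis sorts the rest. *)
Lemma mean_game_sorted t s s' : all is_prob s -> perm_eq s s' ->
  pairwise (fun p q => q <= p) s' -> mean_game t s <= mean_game t s'.
Proof.
elim: s' s t => [|q s' IH] s t hs.
  by move=> /perm_nilP ->.
move=> pss /= /andP[hq hs'].
have qs : q \in s by rewrite (perm_mem pss) mem_head.
move: hs pss; case/splitPr: qs => s1 s2 hs pss.
have pss' : perm_eq (s1 ++ s2) s'.
  by rewrite -(perm_cons q) -(permPr pss) perm_sym perm_catC /= perm_cons perm_catC.
have hpq : is_prob q /\ all is_prob (s1 ++ s2).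
  by move: hs; rewrite !all_cat /= => /and3P[-> -> ->].
apply: (@le_trans _ _ (mean_game t (q :: s1 ++ s2))).
  apply: mean_game_to_front => //; [exact: hpq.1|exact: hpq.2|].
  have : all (fun p => p <= q) (s1 ++ s2) by rewrite (perm_all _ pss').
  by rewrite all_cat => /andP[].
apply: mean_game_cons_le => //; [exact: hpq.1|exact: hpq.1|exact: hpq.2|].
by move=> t'; apply: IH => //; exact: hpq.2.
Qed.

Lemma few_failures_cat_cons t p s1 s2 :
  few_failures t (s1 ++ p :: s2) = few_failures t (p :: s1 ++ s2).
Proof.
elim: s1 t => [//|q s1 IH] [|t] //=.
rewrite !IH /=; case: t => [|t] /=; rewrite ?few_failures0; ring.
Qed.

Lemma few_failures_perm t s s' : perm_eq s s' ->
  few_failures t s = few_failures t s'.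
Proof.
elim: s' s t => [|q s' IH] s t; first by move=> /perm_nilP ->.
move=> pss; have qs : q \in s by rewrite (perm_mem pss) mem_head.
move: pss; case/splitPr: qs => s1 s2 pss.
have pss' : perm_eq (s1 ++ s2) s'.
  by rewrite -(perm_cons q) -(permPr pss) perm_sym perm_catC /= perm_cons perm_catC.
by rewrite few_failures_cat_cons; case: t => [//|t] /=; rewrite !(IH (s1 ++ s2)).
Qed.

(** Sure successes never fail. The users ranked after a given one can thus stay in the list with
    probability 1, and all other users are treated alike. *)
Lemma few_failures_cat1 t s n : few_failures t (s ++ nseq n 1) = few_failures t s.
Proof.
elim: s t => [|p s IH] [|t] //=; last by rewrite !IH.
  by rewrite few_failures0.
by elim: n => //= n ->; ring.
Qed.

(** For equal probabilities the number of failures is binomial; conditioning on the first trial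
    gives Pascal's rule. *)
Lemma few_failures_nseq t n p : few_failures t (nseq n p) =
  \sum_(j < t) 'C(n, j)%:R * p ^+ (n - j) * (1 - p) ^+ j.
Proof.
elim: n t => [|n IH] [|t]; rewrite ?few_failures0 ?big_ord0 //.
  rewrite big_ord_recl /= big1 ?addr0 ?mulr1 // => j _.
  by rewrite bin0n /= !mul0r.
rewrite /= !IH big_ord_recl [in RHS]big_ord_recl /= !bin0 !subn0 !expr0 !mulr1 !mul1r.
rewrite mulrDr -addrA exprS; congr (_ + _).
rewrite !mulr_sumr -big_split /=; apply: eq_bigr => j _.
rewrite /bump /= add1n binS natrD subSS.
(* Subtraction is truncated, so [p * p ^+ (n - j.+1)] equals [p ^+ (n - j)] only for [j < n];
   otherwise the coefficient ['C(n, j.+1)] vanishes. *)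
have [jn|nj] := ltnP j n; last by rewrite bin_small // !(mul0r, mulr0, add0r) exprS; ring.
by rewrite -[(n - j)%N]prednK ?subn_gt0 // -subnS !exprS; ring.
Qed.

(** Linearity of expectation: guess [n] contributes iff it succeeds and fewer than [t] of the
    guesses before it failed, and these two events are independent. *)
Lemma mean_game_few_failures t s : mean_game t s =
  \sum_(n < size s) s`_n * few_failures t (take n s).
Proof.
elim: s t => [|p s IH] t; first by rewrite big_ord0.
case: t => [|t]; first by rewrite big1 // => i _; rewrite few_failures0 mulr0.
rewrite big_ord_recl /= !IH mulrDr mulr1 -addrA; congr (_ + _).
rewrite !mulr_sumr -big_split /=; apply: eq_bigr => n _; ring.
Qed.

End success_number.

(** * Image measures with a density, and transfer of integrals between two of them *)

Section weighted_law.
Context d d' (Omega : measurableType d) (T : measurableType d') (R : realType).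
Variables (mu : {measure set Omega -> \bar R}) (h : Omega -> R) (X : Omega -> T).
Hypotheses (mh : measurable_fun setT h) (h0 : forall w, (0 <= h w)%R)
  (mX : measurable_fun setT X).
Local Open Scope ereal_scope.
Import HBNNSimple.

Let mXS (S : set T) : measurable S -> measurable (X @^-1` S).
Proof. by move=> mS; rewrite -[_ @^-1` _]setTI; exact: mX. Qed.

(** The image under [X] of the measure with density [h] with respect to [mu]. *)
Definition weighted_law (S : set T) : \bar R :=
  \int[mu]_(w in X @^-1` S) (h w)%:E.

Let weighted_law0 : weighted_law set0 = 0.
Proof. by rewrite /weighted_law preimage_set0 integral_set0. Qed.

Let weighted_law_ge0 S : 0 <= weighted_law S.
Proof. by apply: integral_ge0 => w _; rewrite lee_fin. Qed.

Let weighted_law_sigma_additive : semi_sigma_additive weighted_law.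
Proof.
move=> F mF tF mUF; rewrite /weighted_law preimage_bigcup ge0_integral_bigcup//.
- by apply: is_cvg_nneseries => n _ _; apply: integral_ge0 => w _; rewrite lee_fin.
- by move=> n; exact: mXS.
- by apply: measurable_funTS; exact/measurable_EFinP.
- by move=> w _; rewrite lee_fin.
- by move=> i j _ _ [w [Fi Fj]]; apply: tF => //; exists (X w).
Qed.

HB.instance Definition _ := isMeasure.Build _ _ _ weighted_law
  weighted_law0 weighted_law_ge0 weighted_law_sigma_additive.

Definition weighted_measure : {measure set T -> \bar R} := weighted_law.

Lemma weighted_lawE (S : set T) :
  weighted_law S = \int[mu]_w (h w * \1_S (X w))%:E.
Proof.
rewrite /weighted_law integral_mkcond epatch_indic.
by apply: eq_integral => w _ /=; rewrite EFinM !indicE.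
Qed.

(** Monotone convergence along simple approximations of [f]. The right-hand side involves [mu], [h]
    and [X] only through [weighted_law], so equal laws give equal integrals. *)
Lemma integral_weighted_law (f : T -> \bar R) (mf : measurable_fun setT f) :
  (forall x, 0 <= f x) ->
  \int[mu]_w ((h w)%:E * f (X w)) =
  limn (fun n => \sum_(k \in range (nnsfun_approx measurableT mf n))
    k%:E * weighted_law (nnsfun_approx measurableT mf n @^-1` [set k])).
Proof.
move=> f0; pose f_ := nnsfun_approx measurableT mf.
have mf_ n : measurable_fun setT (fun w => f_ n (X w)).
  by apply: measurableT_comp => //; exact: measurable_funP.
transitivity (limn (fun n => \int[mu]_w ((h w)%:E * (f_ n (X w))%:E))).
  rewrite -monotone_convergence//=.
  - apply: eq_integral => w _; apply/esym/cvg_lim => //=.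
    by apply: cvgeZl => //; exact: (cvg_nnsfun_approx measurableT mf).
  - move=> n; apply: emeasurable_funM; first exact/measurable_EFinP.
    by apply/measurable_EFinP; exact: mf_.
  - by move=> n w _; rewrite -EFinM lee_fin mulr_ge0.
  - move=> w _ a b ab; rewrite -!EFinM lee_fin ler_wpM2l//.
    exact/lefP/nd_nnsfun_approx.
congr (limn _); apply/funext => n.
have mpre k : measurable (f_ n @^-1` [set k]).
  by rewrite -[_ @^-1` _]setTI; exact: measurable_funP.
have mind k : measurable_fun setT (fun w => (h w * \1_(f_ n @^-1` [set k]) (X w))%:E).
  apply/measurable_EFinP/measurable_funM => //.
  by apply: measurableT_comp => //; exact: measurable_indic.
transitivity (\sum_(k \in range (f_ n))
    \int[mu]_w (k%:E * (h w * \1_(f_ n @^-1` [set k]) (X w))%:E)).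
  rewrite -ge0_integral_fsum//.
  - apply: eq_integral => w _; rewrite fimfunE -fsumEFin// ge0_mule_fsumr.
      by apply: eq_fsbigr => k _; rewrite -!EFinM mulrCA.
    by move=> k; rewrite nnfun_muleindic_ge0.
  - by move=> k; apply: emeasurable_funM => //.
  - move=> k w _; rewrite -EFinM lee_fin mulrCA mulr_ge0 //.
    by have := nnfun_muleindic_ge0 (f_ n) k (X w); rewrite lee_fin.
apply: eq_fsbigr => k; rewrite inE => -[x _ xk].
rewrite ge0_integralZl ?weighted_lawE// ?lee_fin -?xk//.
by move=> w _; rewrite lee_fin mulr_ge0.
Qed.

End weighted_law.

Section transfer.
Context d1 d2 d' (O1 : measurableType d1) (O2 : measurableType d2)
  (T : measurableType d') (R : realType).
Variables (mu1 : {measure set O1 -> \bar R}) (mu2 : {measure set O2 -> \bar R}).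
Variables (h1 : O1 -> R) (h2 : O2 -> R) (X1 : O1 -> T) (X2 : O2 -> T).
Hypotheses (mh1 : measurable_fun setT h1) (mh2 : measurable_fun setT h2)
  (h10 : forall w, 0 <= h1 w) (h20 : forall w, 0 <= h2 w)
  (mX1 : measurable_fun setT X1) (mX2 : measurable_fun setT X2).
Local Open Scope ereal_scope.
Import HBNNSimple.

Lemma transfer_integral :
  (forall S, measurable S -> \int[mu1]_w (h1 w * \1_S (X1 w))%:E =
                             \int[mu2]_w (h2 w * \1_S (X2 w))%:E) ->
  forall f : T -> R, measurable_fun setT f -> (forall x, (0 <= f x)%R) ->
  \int[mu1]_w (h1 w * f (X1 w))%:E = \int[mu2]_w (h2 w * f (X2 w))%:E.
Proof.
move=> h12 f mf f0.
have mfE : measurable_fun setT (EFin \o f) by exact/measurable_EFinP.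
have f0E x : 0 <= (EFin \o f) x by rewrite lee_fin.
transitivity (\int[mu1]_w ((h1 w)%:E * (EFin \o f) (X1 w))).
  by apply: eq_integral => w _; rewrite EFinM.
transitivity (\int[mu2]_w ((h2 w)%:E * (EFin \o f) (X2 w))); last first.
  by apply: eq_integral => w _; rewrite EFinM.
rewrite (integral_weighted_law mu1 mh1 h10 mX1 mfE f0E).
rewrite (integral_weighted_law mu2 mh2 h20 mX2 mfE f0E).
congr (limn _); apply/funext => n; apply: eq_fsbigr => k _.
rewrite !weighted_lawE h12 // -[_ @^-1` _]setTI; exact: measurable_funP.
Qed.

(** Finite measures that agree on a generating pi-system containing the whole space are equal, so
    agreement has to be checked on [G] only. *)
Lemma transfer_integral_pi (G : set (set T)) :
  measurable = <<s G >> -> setI_closed G -> G setT ->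
  \int[mu1]_w (h1 w)%:E < +oo ->
  (forall S, G S -> \int[mu1]_w (h1 w * \1_S (X1 w))%:E =
                    \int[mu2]_w (h2 w * \1_S (X2 w))%:E) ->
  forall f : T -> R, measurable_fun setT f -> (forall x, (0 <= f x)%R) ->
  \int[mu1]_w (h1 w * f (X1 w))%:E = \int[mu2]_w (h2 w * f (X2 w))%:E.
Proof.
move=> mG IG GT fin h12; apply: transfer_integral => S mS.
rewrite -!weighted_lawE.
apply: (@measure_unique _ _ _ G (fun=> setT) mG IG _ _
  (weighted_measure mu1 mh1 h10 mX1) (weighted_measure mu2 mh2 h20 mX2)) => //.
- by rewrite bigcup_const.
- by move=> A GA; rewrite /weighted_measure /= !weighted_lawE h12.
Qed.

End transfer.

(** * Independent coordinates of a random finite function *)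

Section discrete_independence.
Context {R : realType} {I J : finType}.
Implicit Types (p : I -> J -> R) (c : {ffun I -> J}).

Definition ffun_upd c i j : {ffun I -> J} := [ffun x => if x == i then j else c x].

(** The weight [H], which omits the factor of [i], ignores the value at [i]. Overwriting that value
    is a bijection between the fibres of [c i], so [H] has the same sum over each fibre and the sum
    over [c i] factors out. *)
Lemma sum_ffun_indep p i (psi : J -> R) (phi : {ffun I -> J} -> R) :
  \sum_j p i j = 1 -> (forall c j, phi (ffun_upd c i j) = phi c) ->
  \sum_(c : {ffun I -> J}) (\prod_x p x (c x)) * (psi (c i) * phi c) =
  (\sum_j p i j * psi j) * \sum_(c : {ffun I -> J}) (\prod_x p x (c x)) * phi c.
Proof.
move=> p1 phi_upd.
pose H c := (\prod_(x | x != i) p x (c x)) * phi c.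
have H_upd c j : H (ffun_upd c i j) = H c.
  rewrite /H phi_upd; congr (_ * _); apply: eq_bigr => x xi.
  by rewrite ffunE (negbTE xi).
have H_cst j j' : \sum_(c : {ffun I -> J} | c i == j) H c = \sum_(c : {ffun I -> J} | c i == j') H c.
  rewrite (reindex_onto (fun c => ffun_upd c i j) (fun c => ffun_upd c i j')) /=.
    apply: eq_big => [c|c _]; last exact: H_upd.
    rewrite ffunE eqxx eqxx /=; apply/eqP/eqP => [<-|ci].
      by rewrite ffunE eqxx.
    by apply/ffunP => x; rewrite !ffunE; case: eqP => // ->.
  move=> c /eqP ci; apply/ffunP => x; rewrite !ffunE; case: eqP => // ->.
  by rewrite ci.
have key (f : J -> R) : \sum_(c : {ffun I -> J}) (\prod_x p x (c x)) * (f (c i) * phi c) =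
    \sum_j p i j * f j * \sum_(c : {ffun I -> J} | c i == j) H c.
  rewrite (partition_big (fun c : {ffun I -> J} => c i) predT) //=; apply: eq_bigr => j _.
  rewrite mulr_sumr; apply: eq_bigr => c /eqP ci.
  by rewrite (bigD1 i) //= ci /H; ring.
(* [J] is inhabited, since otherwise the probabilities [p i] would sum to 0. *)
have [j0 _|noJ] := pickP (fun _ : J => true); last first.
  by move: p1; rewrite big_pred0 // => /esym/eqP; rewrite oner_eq0.
have -> : \sum_(c : {ffun I -> J}) (\prod_x p x (c x)) * phi c = \sum_(c : {ffun I -> J} | c i == j0) H c.
  under eq_bigr do rewrite -[phi _]mul1r.
  rewrite (key (fun=> 1)); under eq_bigr do rewrite mulr1 (H_cst _ j0).
  by rewrite -mulr_suml p1 mul1r.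
by rewrite key mulr_suml; apply: eq_bigr => j _; rewrite (H_cst _ j0).
Qed.

(** As [l] has no repetition, the rest of the game does not look at the coordinate of its first
    user, and conditioning on that coordinate gives the recursion of [mean_game]. *)
Lemma mean_gameE p (g : I -> J) t (l : seq I) :
  (forall i, \sum_j p i j = 1) -> uniq l ->
  \sum_(c : {ffun I -> J}) (\prod_x p x (c x)) * (game t [seq g u == c u | u <- l])%:R =
  mean_game t [seq p u (g u) | u <- l].
Proof.
move=> p1; elim: l t => [|u l IH] t; first by rewrite /= big1 // => c _; rewrite mulr0.
case: t => [_|t] /=; first by rewrite big1 // => c _; rewrite mulr0.
move=> /andP[ul uniql]; rewrite -!IH //.
have tail_upd t' c j :
    (game t' [seq g v == ffun_upd c u j v | v <- l])%:R =
    (game t' [seq g v == c v | v <- l])%:R :> R.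
  congr ((game t' _)%:R); apply/eq_in_map => v vl; rewrite ffunE ifN //.
  by apply: contraNneq ul => <-.
have p_hit : \sum_j p u j * (g u == j)%:R = p u (g u).
  rewrite (bigD1 (g u)) //= eqxx mulr1 big1 ?addr0 // => j /negbTE.
  by rewrite eq_sym => ->; rewrite mulr0.
have p_miss : \sum_j p u j * (1 - (g u == j)%:R) = 1 - p u (g u).
  under eq_bigr do rewrite mulrBr mulr1.
  by rewrite sumrB p_hit p1.
have sum1 : \sum_(c : {ffun I -> J}) \prod_x p x (c x) = 1.
  by rewrite -(bigA_distr_bigA p) big1.
have -> : 1 + \sum_(c : {ffun I -> J}) (\prod_x p x (c x)) *
      (game t.+1 [seq g v == c v | v <- l])%:R =
    \sum_(c : {ffun I -> J}) (\prod_x p x (c x)) *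
      (1 + (game t.+1 [seq g v == c v | v <- l])%:R).
  by under [RHS]eq_bigr do rewrite mulrDr mulr1; rewrite big_split /= sum1.
(* Both branch probabilities become means of indicators of the value at [u], so that
   [sum_ffun_indep] can merge each with its tail. *)
rewrite -{1}p_hit -p_miss.
rewrite -(sum_ffun_indep (fun j => (g u == j)%:R)) //; last first.
  by move=> c j; rewrite tail_upd.
rewrite -(sum_ffun_indep (fun j => 1 - (g u == j)%:R)) //.
rewrite -big_split /=; apply: eq_bigr => c _; rewrite -mulrDr; congr (_ * _).
case: (g u == c u) => /=; last by rewrite mul0r add0r subr0 mul1r.
by rewrite -natr1 mul1r subrr mul0r addr0 addrC.
Qed.

End discrete_independence.

(** * Ranking the users by decreasing success probability *)

Section ranking.
Context {R : realType} {U : nat}.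
Implicit Types (p : 'I_U -> R) (u x : 'I_U) (l : seq 'I_U).

(* Ties are broken by the user index, so that [before p] is a strict total
   order whatever [p] is. *)
Definition before p x u := (p u < p x) || ((p x == p u) && (x < u)%N).

Definition others u := [seq x <- enum 'I_U | x != u].

(** The function [v_t] of the formula, evaluated at the value [y] of user [x], except that a tie
    [y = t] is decided by the user indices as in [before]. *)
Definition value_before u x (t y : R) :=
  if (t < y) || ((y == t) && (x < u)%N) then y else 1.

Lemma value_before_is_prob u x (t y : R) :
  is_prob y -> is_prob (value_before u x t y).
Proof. by rewrite /value_before; case: ifP => // _; rewrite /is_prob ler01 lexx. Qed.

(** The value of the game played in the ranked order, written as a sum over users that no longer
    mentions the ranking. *)
Definition ranked_success t p := \sum_u p u *
  few_failures t [seq value_before u x (p u) (p x) | x <- others u].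

Lemma ranked_successE t p l : perm_eq l (enum 'I_U) -> pairwise (before p) l ->
  mean_game t [seq p u | u <- l] = ranked_success t p.
Proof.
move=> pl hl; rewrite mean_game_few_failures size_map /ranked_success.
have [u0|noU] := pickP (fun _ : 'I_U => true); last first.
  have l0 : l = [::] by case: (l) => // a; have := noU a.
  by rewrite l0 big_ord0 big_pred0.
move=> _; rewrite -[RHS]big_enum /= -(perm_big _ pl) /= (big_nth u0) big_mkord.
apply: eq_bigr => -[n ln] _ /=.
rewrite (nth_map u0) //; congr (_ * _); rewrite -map_take.
set u := nth u0 l n.
have lE : l = take n l ++ u :: drop n.+1 l by rewrite -drop_nth // cat_take_drop.
have ul : uniq l by rewrite (perm_uniq pl) enum_uniq.
have pothers : perm_eq (others u) (take n l ++ drop n.+1 l).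
  have -> : take n l ++ drop n.+1 l = [seq x <- l | x != u].
    rewrite [in RHS]lE filter_cat /= eqxx /= -filter_cat; apply/esym/all_filterP/allP.
    move=> x; apply: contraL => /eqP ->.
    by move: ul; rewrite {1}lE uniq_catC /= mem_cat orbC -mem_cat => /andP[].
  by rewrite perm_filter // perm_sym.
have [hb ha] : all (before p ^~ u) (take n l) /\ all (before p u) (drop n.+1 l).
  move: hl; rewrite {1}lE pairwise_cat /= => /and4P[hr _ -> _]; split => //.
  by move: hr; rewrite allrel_consr => /andP[].
rewrite (few_failures_perm _ (perm_map _ pothers)) map_cat.
have -> : [seq value_before u x (p u) (p x) | x <- take n l] = [seq p x | x <- take n l].
  by apply/eq_in_map => x /(allP hb) bx; rewrite /value_before -/(before p x u) bx.
have -> : [seq value_before u x (p u) (p x) | x <- drop n.+1 l] =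
    nseq (size (drop n.+1 l)) 1.
  rewrite -(size_map (fun x => value_before u x (p u) (p x))).
  (* The relation [before] is asymmetric: no user ranked after [u] is also ranked before it. *)
  apply/all_pred1P; rewrite all_map; apply/allP => x /(allP ha) /=.
  rewrite /before /value_before; case: ltgtP => //= _ ux.
  by rewrite ltnNge ltnW.
by rewrite few_failures_cat1.
Qed.

(** Sorting uses the reflexive version [le] of [before], which is total and transitive; absence of
    repetitions makes the resulting order strict. *)
Lemma exists_ranking p :
  exists2 l, perm_eq l (enum 'I_U) & pairwise (before p) l.
Proof.
pose le x y := (p y < p x) || ((p x == p y) && (x <= y)%N).
have le_trans : transitive le.
  move=> y x z /orP[xy|/andP[/eqP xy xy']] /orP[yz|/andP[/eqP yz yz']].
  - by rewrite /le (lt_trans yz xy).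
  - by rewrite /le -yz xy.
  - by rewrite /le xy yz.
  - by rewrite /le xy yz eqxx (leq_trans xy' yz') orbT.
have le_total : total le.
  by move=> x y; rewrite /le; case: ltgtP => //= _; exact: leq_total.
exists (sort le (enum 'I_U)); first by rewrite perm_sort.
have := sort_sorted le_total (enum 'I_U); rewrite sorted_pairwise // => hle.
have := enum_uniq 'I_U; rewrite -(sort_uniq le) uniq_pairwise => hne.
have : pairwise [rel x y | le x y && (x != y)] (sort le (enum 'I_U)).
  by rewrite pairwise_relI hle.
apply: sub_pairwise => x y /= /andP[/orP[xy|/andP[xy lexy]] nxy]; rewrite /before.
  by rewrite xy.
by rewrite xy ltn_neqAle nxy lexy orbT.
Qed.

Lemma mean_game_le_ranked t p l : (forall u, is_prob (p u)) ->
  perm_eq l (enum 'I_U) -> mean_game t [seq p u | u <- l] <= ranked_success t p.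
Proof.
move=> hp pl; have [l' pl' hl'] := exists_ranking p.
rewrite -(ranked_successE t pl' hl'); apply: mean_game_sorted.
- by rewrite all_map; apply/allP => u _; exact: hp.
- by apply: perm_map; rewrite (permPl pl) perm_sym.
rewrite pairwise_map; apply: sub_pairwise hl' => x y /=.
by case/orP => [/ltW//|/andP[/eqP -> _]].
Qed.

Lemma exists_ranking_perm p :
  exists s : {perm 'I_U}, pairwise (before p) [seq s n | n <- enum 'I_U].
Proof.
have [l pl hl] := exists_ranking p.
have /tuple_permP[s sE] : perm_eq l (ord_tuple U) by rewrite val_ord_tuple.
exists s; suff -> : [seq s n | n <- enum 'I_U] = l by [].
by rewrite sE; apply: eq_map => n; rewrite tnth_ord_tuple.
Qed.

Lemma perm_eq_map_perm (s : {perm 'I_U}) :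
  perm_eq [seq s n | n <- enum 'I_U] (enum 'I_U).
Proof.
apply: uniq_perm; [by rewrite (map_inj_uniq perm_inj) enum_uniq|exact: enum_uniq|].
move=> x; rewrite mem_enum; apply/mapP; exists ((s^-1)%g x); rewrite ?mem_enum //.
by rewrite permKV.
Qed.

Lemma ranked_success_ge0 t p : (forall u, is_prob (p u)) -> 0 <= ranked_success t p.
Proof.
move=> hp; have [l pl hl] := exists_ranking p.
rewrite -(ranked_successE t pl hl) mean_game_ge0 // all_map.
by apply/allP => u _; exact: hp.
Qed.

Lemma size_others u : size (others u) = U.-1.
Proof.
by rewrite -{2}(card_ord U) -(cardC1 u) cardE /others enumT.
Qed.

End ranking.

Lemma prodr_bool (R : realType) (I : finType) (A : I -> bool) :
  \prod_i (A i)%:R = [forall i, A i]%:R :> R.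
Proof.
case: (boolP [forall i, A i]) => [/forallP hA|/forallPn[i /negbTE hi]].
  by rewrite big1 // => i _; rewrite hA.
by rewrite (bigD1 i) //= hi mul0r.
Qed.

(** * Integrals of products of functions of independent variables, restricted to an event [B] *)

Section independent_product.
Context d d' (Omega : measurableType d) (T : measurableType d') (R : realType)
  (I : finType).
Variables (mu : {measure set Omega -> \bar R}) (Q : probability T R)
  (X : I -> Omega -> T) (B : set Omega) (C : R).
Hypotheses (mX : forall i, measurable_fun setT (X i)) (mB : measurable B)
  (C0 : 0 <= C).
Hypothesis indep : forall S : I -> set T, (forall i, measurable (S i)) ->
  mu (B `&` [set w | forall i, S i (X i w)]) = (C%:E * \prod_i Q (S i))%E.

Let indep_indic (g : I -> T -> R) (e : I -> R) :
  (forall i, exists2 S, measurable S & g i = \1_S) ->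
  (forall i, (\int[Q]_x (g i x)%:E)%E = (e i)%:E) ->
  (\int[mu]_w (\1_B w * \prod_i g i (X i w))%:E)%E = (C * \prod_i e i)%:E.
Proof.
move=> hg he.
have /choice[S mgS] : forall i, exists S, measurable S /\ g i = \1_S.
  by move=> i; have [S mS gS] := hg i; exists S.
have mBS : measurable (B `&` [set w | forall i, S i (X i w)]).
  apply: measurableI => //.
  have -> : [set w | forall i, S i (X i w)] = \bigcap_(i in [set: I]) (X i @^-1` S i).
    by apply/seteqP; split => w /= hw i; [move=> _; exact: hw|exact: hw].
  apply: fin_bigcap_measurable; first exact: finite_finset.
  by move=> i _; rewrite -[_ @^-1` _]setTI; apply: mX => //; have [] := mgS i.
have eE i : (e i)%:E = Q (S i).
  by rewrite -he; have [mS ->] := mgS i; rewrite integral_indic// setIT.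
transitivity (\int[mu]_w (\1_(B `&` [set w | forall i, S i (X i w)]) w)%:E)%E.
  apply: eq_integral => w _; congr (_%:E); rewrite !indicE in_setI.
  case: (w \in B) => /=; rewrite ?mul0r ?mul1r //.
  have -> : \prod_i g i (X i w) = \prod_i (X i w \in S i)%:R.
    by apply: eq_bigr => i _; have [_ ->] := mgS i; rewrite indicE.
  rewrite prodr_bool; congr ((nat_of_bool _)%:R); apply/forallP/idP => hw.
    by apply/mem_set => i; exact: (set_mem (hw i)).
  by move=> i; apply/mem_set; exact: (set_mem hw).
rewrite integral_indic // setIT indep; last by move=> i; have [] := mgS i.
by rewrite EFinM -prodEFin; congr (_ * _)%E; apply: eq_bigr => i _; rewrite eE.
Qed.

(** The passage from indicators to nonnegative functions is made one index at a time. *)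
Lemma integral_prod_indep (g : I -> T -> R) (e : I -> R) :
  (forall i, measurable_fun setT (g i)) -> (forall i x, 0 <= g i x) ->
  (forall i, (\int[Q]_x (g i x)%:E)%E = (e i)%:E) ->
  (\int[mu]_w (\1_B w * \prod_i g i (X i w))%:E)%E = (C * \prod_i e i)%:E.
Proof.
(* The induction is on the list [s] of indices whose factor need not be an indicator; it starts from
   [indep_indic] and ends with all indices. *)
suff key (s : seq I) : forall (g : I -> T -> R) (e : I -> R),
    (forall i, measurable_fun setT (g i)) -> (forall i x, 0 <= g i x) ->
    (forall i, (\int[Q]_x (g i x)%:E)%E = (e i)%:E) ->
    (forall i, i \notin s -> exists2 S, measurable S & g i = \1_S) ->
    (\int[mu]_w (\1_B w * \prod_i g i (X i w))%:E)%E = (C * \prod_i e i)%:E.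
  by move=> mg g0 he; apply: (key (enum I)) => // i; rewrite mem_enum.
elim: s => [|j s IH] {}g {}e mg g0 he hs.
  by apply: indep_indic => // i; exact: hs.
have e0 i : 0 <= e i.
  by rewrite -lee_fin -he; apply: integral_ge0 => x _; rewrite lee_fin.
have mprod : measurable_fun setT (fun w => \1_B w * \prod_(i | i != j) g i (X i w)).
  apply: measurable_funM; first exact: measurable_indic.
  under eq_fun do rewrite big_mkcond.
  apply: measurable_prod => i _; case: (i != j); last exact: measurable_cst.
  exact: measurableT_comp.
transitivity (\int[Q]_x (C * \prod_(i | i != j) e i * g j (id x))%:E)%E; last first.
  transitivity (\int[Q]_x ((C * \prod_(i | i != j) e i)%:E * (g j x)%:E))%E.
    by apply: eq_integral => x _; rewrite EFinM.
  rewrite ge0_integralZl //; first by rewrite he -EFinM [in RHS](bigD1 j) //= mulrA mulrAC.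
  - exact/measurable_EFinP.
  - by move=> x _; rewrite lee_fin.
  - by rewrite lee_fin mulr_ge0 // prodr_ge0.
transitivity (\int[mu]_w ((\1_B w * \prod_(i | i != j) g i (X i w)) * g j (X j w))%:E)%E.
  by apply: eq_integral => w _; rewrite [in LHS](bigD1 j) //=; congr (_%:E); ring.
(* Only the factor at [j] is varied: the other factors form the density on the left, and the product
   of their means with [C] is the constant density on the right. *)
apply: (@transfer_integral _ _ _ _ _ T R mu Q _ (fun=> C * \prod_(i | i != j) e i)
  (X j) id) => //.
- by move=> w; rewrite mulr_ge0 // prodr_ge0.
- by move=> w; rewrite mulr_ge0 // prodr_ge0.
move=> S mS.
(* With an indicator at [j], the family falls under the induction hypothesis for the shorter
   list. *)
pose g' i := if i == j then \1_S else g i.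
pose e' i := if i == j then fine (Q S) else e i.
have e'E : \prod_i e' i = (\prod_(i | i != j) e i) * fine (Q S).
  rewrite (bigD1 j) //= {1}/e' eqxx mulrC; congr (_ * _); apply: eq_bigr => i.
  by rewrite /e' => /negbTE ->.
transitivity (\int[mu]_w (\1_B w * \prod_i g' i (X i w))%:E)%E.
  apply: eq_integral => w _; congr (_%:E); rewrite [in RHS](bigD1 j) //= {1}/g' eqxx.
  rewrite -mulrA; congr (_ * _); rewrite mulrC; congr (_ * _); apply: eq_bigr => i.
  by rewrite /g' => /negbTE ->.
rewrite (IH g' e').
- rewrite e'E mulrA; transitivity (\int[Q]_x ((C * \prod_(i | i != j) e i)%:E * (\1_S x)%:E))%E.
    rewrite ge0_integralZl //; first by rewrite integral_indic // setIT EFinM fineK // fin_num_measure.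
    - exact/measurable_EFinP/measurable_indic.
    - by rewrite lee_fin mulr_ge0 // prodr_ge0.
  by apply: eq_integral => x _; rewrite EFinM.
- by move=> i; rewrite /g'; case: eqP => // _; exact: measurable_indic.
- by move=> i x; rewrite /g'; case: eqP.
- move=> i; rewrite /g' /e'; case: eqP => // _.
  by rewrite integral_indic // setIT fineK // fin_num_measure.
- move=> i ils; rewrite /g'; case: eqP => [_|/eqP ij]; first by exists S.
  by apply: hs; rewrite inE negb_or ij.
Qed.

End independent_product.

(** * Measurability of finite constructions *)

Lemma ge0_measurable_funV d (T : measurableType d) (R : realType) (f : T -> R) :
  measurable_fun setT f -> (forall x, 0 <= f x) ->
  measurable_fun setT (fun x => (f x)^-1).
Proof.
(* On nonnegative reals the inverse is the real power with exponent -1, also at 0, where both are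
   0. *)
move=> mf f0; have -> : (fun x => (f x)^-1) = (fun x => f x `^ (-1)).
  by apply/funext => x; rewrite powR_inv1.
exact: (measurableT_comp (measurable_powR (-1)) mf).
Qed.

Lemma measurable_all d (T : measurableType d) (I : Type) (s : seq I)
    (b : I -> T -> bool) :
  (forall i, measurable_fun setT (b i)) ->
  measurable_fun setT (fun x => all (b ^~ x) s).
Proof.
move=> mb; elim: s => [|i s IH] /=; first exact: measurable_cst.
exact: measurable_and.
Qed.

Lemma measurable_pairwise d (T : measurableType d) (I : Type) (s : seq I)
    (b : I -> I -> T -> bool) :
  (forall i j, measurable_fun setT (b i j)) ->
  measurable_fun setT (fun x => pairwise (fun i j => b i j x) s).
Proof.
move=> mb; elim: s => [|i s IH] /=; first exact: measurable_cst.
by apply: measurable_and => //; exact: measurable_all.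
Qed.

Lemma measurable_bool_natr d (T : measurableType d) (R : realType)
    (b : T -> bool) :
  measurable_fun setT b -> measurable_fun setT (fun x => (b x)%:R : R).
Proof.
move=> mb; have -> : (fun x => (b x)%:R : R) = (fun x => if b x then 1 else 0).
  by apply/funext => x; case: (b x).
exact: measurable_fun_ifT.
Qed.

Lemma measurable_bigmaxr d (T : measurableType d) (R : realType) (I : Type)
    (s : seq I) (h : I -> T -> R) :
  (forall i, measurable_fun setT (h i)) ->
  measurable_fun setT (fun x => \big[Num.max/0]_(i <- s) h i x).
Proof.
move=> mh; elim: s => [|i s IH].
  by under eq_fun do rewrite big_nil; exact: measurable_cst.
by under eq_fun do rewrite big_cons; exact: measurable_maxr.
Qed.

Lemma measurable_few_failures (R : realType) d (T : measurableType d)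
    (I : Type) t (s : seq I) (g : I -> T -> R) :
  (forall i, measurable_fun setT (g i)) ->
  measurable_fun setT (fun x => few_failures t [seq g i x | i <- s]).
Proof.
move=> mg; elim: s t => [|i s IH] [|t] /=; try exact: measurable_cst.
apply: measurable_funD; apply: measurable_funM => //.
by apply: measurable_funB => //; exact: measurable_cst.
Qed.

Lemma measurable_value_before (R : realType) d (T : measurableType d) (U : nat)
    (u v : 'I_U) (g h : T -> R) :
  measurable_fun setT g -> measurable_fun setT h ->
  measurable_fun setT (fun x => value_before u v (g x) (h x)).
Proof.
move=> mg mh; apply: measurable_fun_ifT => //.
apply: measurable_or; first exact: measurable_fun_ltr.
by apply: measurable_and; [exact: measurable_fun_eqr|exact: measurable_cst].
Qed.

(** * The measurable space of all sweetword lists *)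

Section data_space.
Context d (T : measurableType d) (U k : nat).
Local Notation data := (g_sigma_algebraType (@cylinders d T U k)).

Lemma measurable_coord u m : measurable_fun [set: data] (fun x : data => x u m).
Proof.
move=> _ S mS; rewrite setTI; apply: sub_sigma_algebra.
by exists u, m, S.
Qed.

Lemma measurable_data d' (Omega : measurableType d') (X : Omega -> data) :
  (forall u m, measurable_fun setT (fun w => X w u m)) -> measurable_fun setT X.
Proof.
move=> mX; apply: (@measurability _ _ Omega data setT X (@cylinders d T U k)) => //.
move=> _ [_ [u [m [S [mS ->]]]] <-]; exact: mX.
Qed.

Definition rectangle (S : 'I_U -> 'I_k -> set T) : set data :=
  [set x | forall u m, S u m (x u m)].

Definition rectangles : set (set data) :=
  [set C | exists2 S, (forall u m, measurable (S u m)) & C = rectangle S].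

Lemma measurable_rectangle (S : 'I_U -> 'I_k -> set T) :
  (forall u m, measurable (S u m)) -> measurable (rectangle S).
Proof.
move=> mS.
have -> : rectangle S = \bigcap_(p in [set: 'I_U * 'I_k])
    ((fun x : data => x p.1 p.2) @^-1` S p.1 p.2).
  apply/seteqP; split => x /= hx; first by move=> p _; exact: hx.
  by move=> u m; exact: (hx (u, m)).
apply: fin_bigcap_measurable; first exact: finite_finset.
by move=> p _; rewrite -[_ @^-1` _]setTI; exact: measurable_coord.
Qed.

(** A cylinder is a rectangle with all sides but one equal to [setT]. Unlike the cylinders, the
    rectangles form a pi-system, on which laws can be compared. *)
Lemma measurable_rectangles : (measurable : set (set data)) = <<s rectangles >>.
Proof.
apply/seteqP; split; last first.
  apply: smallest_sub; first exact: sigma_algebra_measurable.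
  by move=> _ [S mS ->]; exact: measurable_rectangle.
apply: smallest_sub; first exact: smallest_sigma_algebra.
move=> _ [u [m [S [mS ->]]]]; apply: sub_sigma_algebra.
exists (fun u' m' => if (u' == u) && (m' == m) then S else setT).
  by move=> u' m'; case: ifP.
apply/seteqP; split => x /=; last by move=> /(_ u m); rewrite !eqxx.
by move=> Sx u' m'; case: ifP => // /andP[/eqP -> /eqP ->].
Qed.

Lemma setI_closed_rectangles : setI_closed rectangles.
Proof.
move=> _ _ [S mS ->] [S' mS' ->]; exists (fun u m => S u m `&` S' u m).
  by move=> u m; exact: measurableI.
apply/seteqP; split => [x [hx hx'] u m|x hx]; first by split; [exact: hx|exact: hx'].
by split => u m; have [] := hx u m.
Qed.

Lemma rectanglesT : rectangles setT.
Proof. by exists (fun _ _ => setT) => //; apply/seteqP; split. Qed.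

End data_space.

(** * Posterior probabilities of the positions within one list *)

Section posterior.
Context d (T : measurableType d) (R : realType) (U k : nat).
Local Notation data := (g_sigma_algebraType (@cylinders d T U k)).
Variable (r : T -> R).
Hypotheses (mr : measurable_fun setT r) (r0 : forall x, 0 <= r x).
Implicit Types (x : data) (u : 'I_U) (m : 'I_k).

(** If every sweetword of the list has [r = 0], division by zero makes this 0 for every [m], and the
    posterior is not a probability vector. *)
Definition posterior x u m : R := r (x u m) / \sum_(j < k) r (x u j).

Lemma mass_ge0 x u : 0 <= \sum_(j < k) r (x u j).
Proof. by apply: sumr_ge0. Qed.

Lemma posterior_ge0 x u m : 0 <= posterior x u m.
Proof. by rewrite divr_ge0 ?mass_ge0. Qed.

Lemma posterior_le1 x u m : posterior x u m <= 1.
Proof.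
rewrite /posterior; have [->|s0] := eqVneq (\sum_(j < k) r (x u j)) 0.
  by rewrite invr0 mulr0.
rewrite ler_pdivrMr ?lt0r ?s0 ?mass_ge0 // mul1r (bigD1 m) //= lerDl.
exact: sumr_ge0.
Qed.

Lemma sum_posterior x u : \sum_m posterior x u m =
  if \sum_(j < k) r (x u j) == 0 then 0 else 1.
Proof.
rewrite /posterior -mulr_suml; case: eqP => [->|/eqP s0]; first by rewrite mul0r.
by rewrite divff.
Qed.

(** This holds for a list of mass 0 too: a zero sum of nonnegative terms forces each [r (x u m)] to
    be 0. *)
Lemma posteriorK x u m : posterior x u m * \sum_(j < k) r (x u j) = r (x u m).
Proof.
rewrite /posterior; have [s0|s0] := eqVneq (\sum_(j < k) r (x u j)) 0; last first.
  by rewrite divfK.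
rewrite s0 mulr0; apply/esym.
exact: (@psumr_eq0P _ _ predT (fun j => r (x u j)) (fun j _ => r0 _) s0).
Qed.

Lemma measurable_posterior u m : measurable_fun setT (fun x => posterior x u m).
Proof.
have ms : measurable_fun setT (fun x => \sum_(j < k) r (x u j)).
  apply: measurable_sum => j; apply: measurableT_comp => //.
  exact: measurable_coord.
apply: measurable_funM.
  by apply: measurableT_comp => //; exact: measurable_coord.
by apply: ge0_measurable_funV => // x; exact: mass_ge0.
Qed.

Lemma wvalE x u : wval r (x u) = \big[Num.max/0]_m posterior x u m.
Proof. by []. Qed.

Lemma posterior_le_wval x u m : posterior x u m <= wval r (x u).
Proof. by rewrite wvalE; exact: le_bigmax. Qed.

Lemma wval_is_prob x u : is_prob (wval r (x u)).
Proof.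
rewrite /is_prob wvalE; apply/andP; split.
  by rewrite bigmax_ge_id.
by apply: bigmax_le => [|m _]; [exact: ler01|exact: posterior_le1].
Qed.

(** The default 0 of the maximum cannot exceed the posteriors, which are nonnegative, and [0 < k]
    provides an index. *)
Lemma wval_attained x u : (0 < k)%N -> exists m, posterior x u m = wval r (x u).
Proof.
move=> k0; rewrite wvalE.
case: (@eq_bigmax _ _ _ 0 (Ordinal k0) predT (posterior x u)) => // [m _|m _ ->].
  exact: posterior_ge0.
by exists m.
Qed.

Lemma measurable_wval u : measurable_fun setT (fun x : data => wval r (x u)).
Proof.
by apply: measurable_bigmaxr => m; exact: measurable_posterior.
Qed.

(** The maximum of [k] numbers of sum 1 is at least their mean. This is the origin of the lower
    limit of integration in the formula. *)
Lemma wval_ge_invk x u : \sum_(j < k) r (x u j) != 0 -> k%:R^-1 <= wval r (x u).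
Proof.
move=> s0; have : \sum_m posterior x u m = 1 by rewrite sum_posterior (negbTE s0).
have [k0|k0] := posnP k.
  by move: s0; rewrite big1 ?eqxx // => -[j jk]; exfalso; rewrite k0 in jk.
move=> s1; rewrite -div1r ler_pdivrMr ?ltr0n //.
apply: (@le_trans _ _ (\sum_m posterior x u m)); first by rewrite s1.
apply: le_trans (ler_sum _ (fun m _ => posterior_le_wval x u m)) _.
by rewrite sumr_const card_ord mulr_natr.
Qed.

End posterior.

(** * The probabilistic model and the posterior law of the positions *)

Section model.
Context (R : realType) (d : measure_display) (T : measurableType d)
  (P Q : probability T R) (r : T -> R) (k U : nat)
  (dO : measure_display) (Omega : measurableType dO) (Pr : probability Omega R)
  (real : 'I_U -> Omega -> T) (hon : 'I_U -> 'I_k -> Omega -> T)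
  (pos : 'I_U -> Omega -> 'I_k).
Hypotheses (k0 : (0 < k)%N) (mr : measurable_fun setT r)
  (r0 : forall x, 0 <= r x)
  (rE : forall S, measurable S -> P S = (\int[Q]_(x in S) (r x)%:E)%E)
  (mreal : forall u, measurable_fun setT (real u))
  (mhon : forall u m, measurable_fun setT (hon u m))
  (mpos : forall u c, measurable (pos u @^-1` [set c]))
  (indep : forall (SA : 'I_U -> set T) (SB : 'I_U -> 'I_k -> set T)
      (c : 'I_U -> 'I_k),
    (forall u, measurable (SA u)) -> (forall u m, measurable (SB u m)) ->
    Pr (\bigcap_(u in setT)
          (real u @^-1` SA u `&` pos u @^-1` [set c u]
           `&` \bigcap_(m in setT) hon u m @^-1` SB u m))
    = (\prod_(u < U) (P (SA u) * ((k%:R)^-1)%:E * \prod_(m < k) Q (SB u m)))%E).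
Local Notation data := (g_sigma_algebraType (@cylinders d T U k)).
Local Notation positions := {ffun 'I_U -> 'I_k}.
Implicit Types (c : positions) (f : data -> R).

Let sweets (w : Omega) : data := sweet real hon pos w.
Let honeys (w : Omega) : data := fun u m => hon u m w.

Definition at_positions c : set Omega := [set w | forall u, pos u w = c u].

Lemma measurable_at_positions c : measurable (at_positions c).
Proof.
have -> : at_positions c = \bigcap_(u in [set: 'I_U]) (pos u @^-1` [set c u]).
  by apply/seteqP; split => w /= hw u; [move=> _; exact: hw|exact: hw].
by apply: fin_bigcap_measurable => //; exact: finite_finset.
Qed.

Lemma measurable_sweets : measurable_fun setT sweets.
Proof.
apply: measurable_data => u m; rewrite /sweets /sweet.
apply: measurable_fun_ifT => //; apply: (measurable_fun_bool true).
rewrite setTI (_ : _ @^-1` _ = pos u @^-1` [set m]) //.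
by apply/seteqP; split => w /=; [move=> /eqP ->|move=> ->; rewrite eqxx].
Qed.

Lemma measurable_honeys : measurable_fun setT honeys.
Proof. by apply: measurable_data => u m; exact: mhon. Qed.

Lemma sum_at_positions w : \sum_(c : positions) \1_(at_positions c) w = 1 :> R.
Proof.
pose c0 := [ffun u => pos u w] : positions.
rewrite (bigD1 c0) //= indicE mem_set => [|u]; last by rewrite ffunE.
rewrite big1 ?addr0 // => c cc0; rewrite indicE memNset //= => hw.
by move/eqP: cc0; apply; apply/ffunP => u; rewrite ffunE hw.
Qed.

Let pr_fin d' (T' : measurableType d') (mu : probability T' R) (S : set T') :
  measurable S -> mu S = (fine (mu S))%:E.
Proof. by move=> mS; rewrite fineK // fin_num_measure. Qed.

Lemma indep_fine (SA : 'I_U -> set T) (SB : 'I_U -> 'I_k -> set T) c :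
  (forall u, measurable (SA u)) -> (forall u m, measurable (SB u m)) ->
  Pr (at_positions c `&`
      [set w | forall u, SA u (real u w) /\ forall m, SB u m (hon u m w)]) =
  ((k%:R^-1) ^+ U *
   \prod_u (fine (P (SA u)) * \prod_m fine (Q (SB u m))))%:E.
Proof.
move=> mSA mSB; transitivity (Pr (\bigcap_(u in setT)
          (real u @^-1` SA u `&` pos u @^-1` [set c u]
           `&` \bigcap_(m in setT) hon u m @^-1` SB u m))).
  congr (Pr _); apply/seteqP; split => w /=.
    by move=> [hc hw] u _; have [hA hB] := hw u; split => [|m _]; [split|exact: hB].
  move=> hw; split => u; have [[hA hc] hB] := hw u I => //.
  by split => // m; exact: hB.
rewrite indep //.
transitivity (\prod_(u < U)
    (k%:R^-1 * (fine (P (SA u)) * \prod_m fine (Q (SB u m))))%:E)%E.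
  apply: eq_bigr => u _; rewrite (pr_fin P) // (eq_bigr (fun m => (fine (Q (SB u m)))%:E)).
    by rewrite prodEFin -!EFinM; congr (_%:E); ring.
  by move=> m _; rewrite -pr_fin.
by rewrite prodEFin big_split /= prodr_const card_ord.
Qed.

(** Independence with the passwords left unconstrained, in the form that [integral_prod_indep]
    expects for the event [at_positions c], whose mass is [k%:R^-1 ^+ U]. *)
Lemma honeys_indep c (S : 'I_U * 'I_k -> set T) :
  (forall p, measurable (S p)) ->
  Pr (at_positions c `&` [set w | forall p, S p (hon p.1 p.2 w)]) =
  (((k%:R^-1) ^+ U)%:E * \prod_p Q (S p))%E.
Proof.
move=> mS; have := @indep_fine (fun=> setT) (fun u m => S (u, m)) c _ _.
rewrite (_ : [set w | forall u, setT (real u w) /\ _] =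
             [set w | forall p, S p (hon p.1 p.2 w)]); last first.
  apply/seteqP; split => w /= hw; first by move=> [u m]; have [_] := hw u; exact.
  by move=> u; split => // m; exact: (hw (u, m)).
move=> -> //; rewrite EFinM; congr (_ * _)%E.
rewrite (eq_bigr (fun p => (fine (Q (S p)))%:E)) => [|p _]; last by rewrite -pr_fin.
rewrite prodEFin; congr (_%:E).
rewrite (eq_bigr (fun u => \prod_m fine (Q (S (u, m))))) => [|u _].
  by rewrite pair_big /=; apply: eq_bigr => -[].
by rewrite probability_setT mul1r.
Qed.

Lemma sweets_rectangle (S : 'I_U -> 'I_k -> set T) c :
  (forall u m, measurable (S u m)) ->
  Pr (at_positions c `&` sweets @^-1` rectangle S) =
  ((k%:R^-1) ^+ U *
   \prod_u \prod_m fine (if m == c u then P (S u m) else Q (S u m)))%:E.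
Proof.
(* The honeyword at the position of the password is overwritten, so its constraint is released and
   put on the password instead. *)
move=> mS; pose SB u m := if m == c u then setT else S u m.
have mSB u m : measurable (SB u m) by rewrite /SB; case: ifP.
transitivity (Pr (at_positions c `&`
    [set w | forall u, S u (c u) (real u w) /\ forall m, SB u m (hon u m w)])).
  congr (Pr _); apply/seteqP; split => w [hc hw]; split => // u.
    split; first by have := hw u (c u); rewrite /sweets /sweet hc eqxx.
    move=> m; rewrite /SB; case: ifPn => // mc.
    by have := hw u m; rewrite /sweets /sweet hc (negbTE mc).
  move=> m; have [hA hB] := hw u; rewrite /sweets /sweet hc.
  by case: eqP => [->//|/eqP mc]; have := hB m; rewrite /SB (negbTE mc).
rewrite (@indep_fine (fun u => S u (c u)) SB) //; congr ((_ * _)%:E); apply: eq_bigr => u _.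
rewrite [in RHS](bigD1 (c u)) //= eqxx; congr (_ * _).
rewrite (bigD1 (c u)) //= {1}/SB eqxx probability_setT mul1r.
by apply: eq_bigr => m /negbTE mc; rewrite /SB mc.
Qed.

(* The honeywords are i.i.d. with law [Q] over all the positions, including the
   one occupied by the password, so they serve as the reference product measure
   with respect to which the sweetword list has a density. *)
Lemma sweets_density c c0 f : measurable_fun setT f -> (forall x, 0 <= f x) ->
  (\int[Pr]_w (\1_(at_positions c) w * f (sweets w))%:E)%E =
  (\int[Pr]_w (\1_(at_positions c0) w * (\prod_u r (honeys w u (c u)))
                * f (honeys w))%:E)%E.
Proof.
have mr' u m : measurable_fun setT (fun w => r (honeys w u m)).
  by apply: measurableT_comp => //; exact: mhon.
apply: (@transfer_integral_pi _ _ _ _ _ data R Pr Pr (\1_(at_positions c))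
  (fun w => \1_(at_positions c0) w * \prod_u r (honeys w u (c u)))
  sweets honeys _ _ _ _ _ _ (@rectangles d T U k)) => //.
- by apply: measurable_indic; exact: measurable_at_positions.
- apply: measurable_funM.
    by apply: measurable_indic; exact: measurable_at_positions.
  by apply: measurable_prod => u _; exact: mr'.
- by move=> w; rewrite mulr_ge0 // prodr_ge0.
- exact: measurable_sweets.
- exact: measurable_honeys.
- exact: measurable_rectangles.
- exact: setI_closed_rectangles.
- exact: rectanglesT.
- rewrite integral_indic //; last exact: measurable_at_positions.
  rewrite setIT (le_lt_trans (probability_le1 _ _)) ?ltry //.
  exact: measurable_at_positions.
move=> _ [S mS ->].
transitivity (Pr (at_positions c `&` sweets @^-1` rectangle S)).
  rewrite -[X in Pr X]setIT -integral_indic //.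
    apply: eq_integral => w _; rewrite indicI /=; congr ((_ * _)%:E).
  apply: measurableI; first exact: measurable_at_positions.
  rewrite -[X in measurable X]setTI; apply: measurable_sweets => //.
  exact: measurable_rectangle.
rewrite sweets_rectangle //.
(* The integrand on the right splits over the slots [p]: each contributes its side of the rectangle
   and, at the password position, the density [r]. The value [e p] is the integral of this factor
   against [Q]. *)
pose g (p : 'I_U * 'I_k) x :=
  \1_(S p.1 p.2) x * (if p.2 == c p.1 then r x else 1).
pose e (p : 'I_U * 'I_k) :=
  fine (if p.2 == c p.1 then P (S p.1 p.2) else Q (S p.1 p.2)).
transitivity (\int[Pr]_w (\1_(at_positions c0) w *
    \prod_p g p (hon p.1 p.2 w))%:E)%E; last first.
  apply: eq_integral => w _; rewrite -mulrA; congr ((_ * _)%:E).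
  rewrite big_split /= mulrC; congr (_ * _).
    rewrite -(pair_bigA _ (fun u m => if m == c u then r (hon u m w) else 1)) /=.
    apply: eq_bigr => u _; rewrite (bigD1 (c u)) //= eqxx big1 ?mulr1 // => m.
    by move=> /negbTE ->.
  transitivity (\prod_(p : 'I_U * 'I_k) (hon p.1 p.2 w \in S p.1 p.2)%:R : R).
    by apply: eq_bigr => p _; rewrite indicE.
  rewrite prodr_bool indicE; congr ((nat_of_bool _)%:R); apply/forallP/idP => hw.
    by apply/mem_set => u m; apply: set_mem; exact: (hw (u, m)).
  by move=> p; apply/mem_set; exact: (set_mem hw).
rewrite (@integral_prod_indep _ _ _ _ _ _ Pr Q (fun p => hon p.1 p.2) _
  (k%:R^-1 ^+ U) _ _ _ _ g e) //.
- by congr ((_ * _)%:E); rewrite pair_big.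
- exact: measurable_at_positions.
- exact: honeys_indep.
- move=> p; apply: measurable_funM; first exact: measurable_indic.
  by case: (p.2 == c p.1); [exact: mr|exact: measurable_cst].
- by move=> p x; rewrite mulr_ge0 //; case: ifP.
move=> [u m]; rewrite /g /e /=; case: ifP => _; last first.
  rewrite -pr_fin // -[X in Q X]setIT -integral_indic //.
  by apply: eq_integral => x _; rewrite mulr1.
rewrite -pr_fin // rE // [in RHS]integral_mkcond epatch_indic.
by apply: eq_integral => x _ /=; rewrite mulrC EFinM.
Qed.

Definition positions_prob (x : data) c : R := \prod_u posterior r x u (c u).

Lemma positions_prob_ge0 x c : 0 <= positions_prob x c.
Proof. by apply: prodr_ge0 => u _; exact: posterior_ge0. Qed.

Lemma measurable_positions_prob c :
  measurable_fun setT (fun x : data => positions_prob x c).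
Proof. by apply: measurable_prod => u _; exact: measurable_posterior. Qed.

(** Bayes' rule. The right-hand side is split over the actual positions [c'] and moved to the
    honeywords by [sweets_density]. Summing the densities over [c'] gives the product of the masses
    of the lists, which cancels the denominators of the posterior and leaves the density for [c]. *)
Lemma sweets_posterior c f : measurable_fun setT f -> (forall x, 0 <= f x) ->
  (\int[Pr]_w (\1_(at_positions c) w * f (sweets w))%:E)%E =
  (\int[Pr]_w (positions_prob (sweets w) c * f (sweets w))%:E)%E.
Proof.
move=> mf f0.
pose g x := positions_prob x c * f x.
have mg : measurable_fun setT g.
  by apply: measurable_funM => //; exact: measurable_positions_prob.
have g0 x : 0 <= g x by rewrite mulr_ge0 // positions_prob_ge0.
have mindic c' : measurable_fun setT (\1_(at_positions c') : Omega -> R).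
  by apply: measurable_indic; exact: measurable_at_positions.
transitivity (\int[Pr]_w (\sum_(c' : positions)
    (\1_(at_positions c') w * g (sweets w))%:E))%E; last first.
  by apply: eq_integral => w _; rewrite sumEFin -mulr_suml sum_at_positions mul1r.
rewrite ge0_integral_sum //.
(* Every term is referred to the same event [at_positions c], so that only the densities depend on
   [c']. *)
- rewrite (eq_bigr (fun c' : positions => \int[Pr]_w (\1_(at_positions c) w *
      (\prod_u r (honeys w u (c' u))) * g (honeys w))%:E)%E); last first.
    by move=> c' _; exact: sweets_density.
  rewrite (sweets_density c c mf f0) -ge0_integral_sum //.
  + apply: eq_integral => w _; rewrite sumEFin; congr (_%:E).
    rewrite -mulr_suml -mulr_sumr -!mulrA; congr (_ * _).
    rewrite -(bigA_distr_bigA (fun u m => r (honeys w u m))) /g mulrA; congr (_ * _).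
    rewrite /positions_prob -big_split /=; apply: eq_bigr => u _.
    by rewrite mulrC posteriorK.
  + move=> c'; apply/measurable_EFinP; apply: measurable_funM; last first.
      by apply: measurableT_comp => //; exact: measurable_honeys.
    apply: measurable_funM => //; apply: measurable_prod => u _.
    by apply: measurableT_comp => //; exact: mhon.
  + by move=> c' w _; rewrite lee_fin mulr_ge0 // mulr_ge0 // prodr_ge0.
- move=> c'; apply/measurable_EFinP; apply: measurable_funM => //.
  by apply: measurableT_comp => //; exact: measurable_sweets.
- by move=> c' w _; rewrite lee_fin mulr_ge0.
Qed.

Lemma sum_positions_prob x :
  \sum_(c : positions) positions_prob x c =
  [forall u, \sum_(j < k) r (x u j) != 0]%:R.
Proof.
rewrite /positions_prob -(bigA_distr_bigA (posterior r x)) -prodr_bool.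
by apply: eq_bigr => u _; rewrite sum_posterior; case: eqP.
Qed.

(** Data with a list of mass 0 are negligible: replacing the indicators of the positions, of sum 1,
    by the posterior probabilities, of sum 0 on such data, leaves the integral unchanged. *)
Lemma integral_sweets f : measurable_fun setT f -> (forall x, 0 <= f x) ->
  (\int[Pr]_w (f (sweets w))%:E)%E =
  (\int[Pr]_w ([forall u, \sum_(j < k) r (sweets w u j) != 0]%:R
               * f (sweets w))%:E)%E.
Proof.
move=> mf f0.
transitivity (\int[Pr]_w (\sum_(c : positions)
    (\1_(at_positions c) w * f (sweets w))%:E))%E.
  by apply: eq_integral => w _; rewrite sumEFin -mulr_suml sum_at_positions mul1r.
rewrite ge0_integral_sum //.
- rewrite (eq_bigr _ (fun c _ => sweets_posterior c mf f0)) -ge0_integral_sum //.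
  + by apply: eq_integral => w _; rewrite sumEFin -mulr_suml sum_positions_prob.
  + move=> c; apply/measurable_EFinP.
    apply: (measurableT_comp (f := fun x => positions_prob x c * f x)).
      by apply: measurable_funM => //; exact: measurable_positions_prob.
    exact: measurable_sweets.
  + by move=> c w _; rewrite lee_fin mulr_ge0 // positions_prob_ge0.
- move=> c; apply/measurable_EFinP; apply: measurable_funM.
    by apply: measurable_indic; exact: measurable_at_positions.
  by apply: measurableT_comp => //; exact: measurable_sweets.
- by move=> c w _; rewrite lee_fin mulr_ge0.
Qed.

(** * Conditional value of a list of guesses given the sweetwords, and the optimal attacker *)

Definition guess_value i (x : data) (o : guesses U k) : R :=
  \sum_(c : positions) positions_prob x c *
    (game i [seq o.2 (o.1 n) == c (o.1 n) | n <- enum 'I_U])%:R.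

Lemma guess_value_ge0 i x o : 0 <= guess_value i x o.
Proof.
by apply: sumr_ge0 => c _; rewrite mulr_ge0 ?ler0n // positions_prob_ge0.
Qed.

Lemma measurable_guess_value i o :
  measurable_fun setT (fun x : data => guess_value i x o).
Proof.
apply: measurable_sum => c; apply: measurable_funM; last exact: measurable_cst.
exact: measurable_positions_prob.
Qed.

Lemma guess_valueE i x o : guess_value i x o =
  [forall u, \sum_(j < k) r (x u j) != 0]%:R *
  mean_game i [seq posterior r x (o.1 n) (o.2 (o.1 n)) | n <- enum 'I_U].
Proof.
case: (boolP [forall u, _]) => [/forallP hx|hx]; rewrite ?mul1r ?mul0r.
  have hp u : \sum_m posterior r x u m = 1 by rewrite sum_posterior (negbTE (hx u)).
  have ul : uniq [seq o.1 n | n <- enum 'I_U].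
    by rewrite (map_inj_uniq perm_inj) enum_uniq.
  transitivity (mean_game i
      [seq posterior r x u (o.2 u) | u <- [seq o.1 n | n <- enum 'I_U]]).
    rewrite -(mean_gameE o.2 i hp ul); apply: eq_bigr => c _.
    by rewrite -[in RHS]map_comp.
  by rewrite -[in LHS]map_comp.
have /psumr_eq0P h0 : \sum_(c : positions) positions_prob x c = 0.
  by rewrite sum_positions_prob (negbTE hx).
rewrite /guess_value big1 // => c _; rewrite h0 ?mul0r //.
by move=> c' _; exact: positions_prob_ge0.
Qed.

(** The attacker sees only the lists, so its kernel is a function of the data, and the positions can
    be averaged by [sweets_posterior] separately for each output. *)
Lemma expected_successE A i : attacker A ->
  expected_success Pr real hon pos A i =
  (\int[Pr]_w (\sum_(o : guesses U k) A (sweets w) o *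
                 guess_value i (sweets w) o)%:E)%E.
Proof.
move=> [A0 A1 mA].
have mA' o : measurable_fun setT (fun x : data => A x o).
  by move=> _ B mB; rewrite setTI; exact: mA.
pose F (p : guesses U k * positions) (x : data) : R := A x p.1 *
  (game i [seq p.1.2 (p.1.1 n) == p.2 (p.1.1 n) | n <- enum 'I_U])%:R.
have mF p : measurable_fun setT (F p).
  by apply: measurable_funM => //; exact: measurable_cst.
have F0 p x : 0 <= F p x by rewrite mulr_ge0 ?ler0n.
transitivity (\int[Pr]_w (\sum_(p : guesses U k * positions)
    (\1_(at_positions p.2) w * F p (sweets w))%:E))%E.
  rewrite /expected_success; apply: eq_integral => w _.
  rewrite sumEFin; congr (_%:E).
  rewrite -(pair_bigA _ (fun o c => \1_(at_positions c) w * F (o, c) (sweets w))) /=.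
  apply: eq_bigr => o _; rewrite /F /=.
  (* On [at_positions c] the outcomes of the guesses are determined by [o] and [c]. *)
  rewrite -[LHS]mul1r -[X in X * _ = _](sum_at_positions w) mulr_suml; apply: eq_bigr => c _.
  rewrite indicE; case: (boolP (w \in _)) => [/set_mem hw|_]; last by rewrite !mul0r.
  congr (_ * (_ * _%:R)); congr (game i _); apply: eq_map => n.
  by rewrite hw.
rewrite ge0_integral_sum //.
- rewrite (eq_bigr _ (fun p _ => sweets_posterior p.2 (mF p) (F0 p))).
  rewrite -ge0_integral_sum //.
  + apply: eq_integral => w _; rewrite sumEFin; congr (_%:E).
    rewrite -(pair_bigA _ (fun o c => positions_prob (sweets w) c * F (o, c) (sweets w))) /=.
    apply: eq_bigr => o _; rewrite /guess_value mulr_sumr; apply: eq_bigr => c _.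
    by rewrite /F /= mulrCA.
  + move=> p; apply/measurable_EFinP.
    apply: (measurableT_comp (f := fun x => positions_prob x p.2 * F p x)).
      by apply: measurable_funM => //; exact: measurable_positions_prob.
    exact: measurable_sweets.
  + by move=> p w _; rewrite lee_fin mulr_ge0 // positions_prob_ge0.
- move=> p; apply/measurable_EFinP; apply: measurable_funM.
    by apply: measurable_indic; exact: measurable_at_positions.
  by apply: measurableT_comp => //; exact: measurable_sweets.
- by move=> p w _; rewrite lee_fin mulr_ge0.
Qed.

Let weight (x : data) u := wval r (x u).

Lemma measurable_before u x' :
  measurable_fun setT (fun x : data => before (weight x) u x').
Proof.
have mw v : measurable_fun setT (fun x : data => weight x v).
  exact: measurable_wval.
rewrite /before; apply: measurable_or; first exact: measurable_fun_ltr.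
by apply: measurable_and; [exact: measurable_fun_eqr|exact: measurable_cst].
Qed.

Lemma measurable_ranked_success i :
  measurable_fun setT (fun x : data => ranked_success i (weight x)).
Proof.
apply: measurable_sum => u; apply: measurable_funM; first exact: measurable_wval.
apply: (@measurable_few_failures R _ data _ i (others u) (fun v x =>
  value_before u v (weight x u) (weight x v))) => v.
by apply: measurable_value_before; exact: measurable_wval.
Qed.

(** Each posterior is raised to the maximum for its user, and then the users are ranked. The
    indicator makes both sides 0 on data with a list of mass 0. *)
Lemma guess_value_le i x o : guess_value i x o <=
  [forall u, \sum_(j < k) r (x u j) != 0]%:R * ranked_success i (weight x).
Proof.
rewrite guess_valueE; apply: ler_wpM2l; first exact: ler0n.
have pw u : is_prob (weight x u) by exact: wval_is_prob.
apply: le_trans (mean_game_le_ranked i pw (perm_eq_map_perm o.1)).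
rewrite -[in leRHS]map_comp; apply: mean_game_mono => n; last exact: posterior_le_wval.
  by rewrite /is_prob posterior_ge0 // posterior_le1.
exact: pw.
Qed.

Definition optimal_guess (x : data) (o : guesses U k) : bool :=
  all (fun u => posterior r x u (o.2 u) == weight x u) (enum 'I_U) &&
  pairwise (before (weight x)) [seq o.1 n | n <- enum 'I_U].

Lemma optimal_guess_exists x : exists o, optimal_guess x o.
Proof.
have [s hs] := exists_ranking_perm (weight x).
have /choice[g hg] : forall u, exists m, posterior r x u m = weight x u.
  by move=> u; exact: wval_attained.
exists (s, [ffun u => g u]); rewrite /optimal_guess hs andbT.
by apply/allP => u _; rewrite ffunE hg.
Qed.

Lemma optimal_guess_value i x o : optimal_guess x o -> guess_value i x o =
  [forall u, \sum_(j < k) r (x u j) != 0]%:R * ranked_success i (weight x).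
Proof.
move=> /andP[/allP hg hs]; rewrite guess_valueE; congr (_ * _).
rewrite -(ranked_successE i (perm_eq_map_perm o.1) hs) -[in RHS]map_comp.
congr (mean_game i _); apply: eq_map => n /=.
by apply/eqP/hg; rewrite mem_enum.
Qed.

(** Uniform over all optimal outputs. Being symmetric in them, it is measurable without a measurable
    choice of a best sweetword when several are tied. *)
Definition optimal_attacker (x : sweetdata T U k) (o : guesses U k) : R :=
  (optimal_guess x o)%:R / \sum_o' (optimal_guess x o')%:R.

Lemma optimal_attackerP : attacker optimal_attacker.
Proof.
have sum_gt0 x : 0 < \sum_o' (optimal_guess x o')%:R :> R.
  have [g hg] := optimal_guess_exists x.
  by rewrite (bigD1 g) //= hg ltr_pwDl // sumr_ge0.
have mopt o : measurable_fun setT (fun x : data => (optimal_guess x o)%:R : R).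
  apply: measurable_bool_natr; apply: measurable_and.
    apply: measurable_all => u; apply: measurable_fun_eqr.
      exact: measurable_posterior.
    exact: measurable_wval.
  by apply: measurable_pairwise => u v; exact: measurable_before.
split => [x o|x|o B mB]; first by rewrite divr_ge0 // ltW.
  by rewrite -mulr_suml divff // gt_eqF.
have mA : measurable_fun setT (fun x : data => optimal_attacker x o).
  apply: measurable_funM => //; apply: ge0_measurable_funV => [|x]; last exact: ltW.
  exact: measurable_sum.
by rewrite -[X in <<s _ >> X]setTI; exact: mA.
Qed.

Lemma expected_success_le A i : attacker A ->
  (expected_success Pr real hon pos A i <=
   \int[Pr]_w (ranked_success i (weight (sweets w)))%:E)%E.
Proof.
move=> hA; have [A0 A1 mA] := hA.
have mA' o : measurable_fun setT (fun x : data => A x o).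
  by move=> _ B mB; rewrite setTI; exact: mA.
have ranked0 x : 0 <= ranked_success i (weight x).
  by apply: ranked_success_ge0 => u; exact: wval_is_prob.
(* The indicator from [guess_value_le] is inserted on the right; the comparison is then pointwise,
   averaging over the outputs of [A]. *)
rewrite expected_successE // [leRHS](integral_sweets (measurable_ranked_success i)) //.
apply: ge0_le_integral => //.
- move=> w _; rewrite lee_fin sumr_ge0 // => o _.
  by rewrite mulr_ge0 // guess_value_ge0.
- apply/measurable_EFinP.
  apply: (measurableT_comp (f := fun x : data => \sum_o A x o * guess_value i x o)).
    apply: measurable_sum => o; apply: measurable_funM => //.
    exact: measurable_guess_value.
  exact: measurable_sweets.
- apply/measurable_EFinP.
  apply: (measurableT_comp (f := fun x : data => [forall u, \sum_(j < k) r (x u j) != 0]%:R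
     * ranked_success i (weight x))); last exact: measurable_sweets.
  apply: measurable_funM; last exact: measurable_ranked_success.
  have -> : (fun x : data => [forall u, \sum_(j < k) r (x u j) != 0]%:R) =
      (fun x => \sum_(c : positions) positions_prob x c).
    by apply/funext => x; rewrite sum_positions_prob.
  by apply: measurable_sum => c; exact: measurable_positions_prob.
move=> w _; rewrite lee_fin -[leRHS]mul1r -[X in _ <= X * _](A1 (sweets w)) mulr_suml.
apply: ler_sum => o _; apply: ler_wpM2l => //; exact: guess_value_le.
Qed.

Lemma expected_success_optimal i :
  expected_success Pr real hon pos optimal_attacker i =
  (\int[Pr]_w (ranked_success i (weight (sweets w)))%:E)%E.
Proof.
have ranked0 x : 0 <= ranked_success i (weight x).
  by apply: ranked_success_ge0 => u; exact: wval_is_prob.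
have hA := optimal_attackerP; have [_ A1 _] := hA.
rewrite expected_successE // [RHS](integral_sweets (measurable_ranked_success i)) //.
apply: eq_integral => w _; congr (_%:E).
rewrite -[RHS]mul1r -[X in _ = X * _](A1 (sweets w)) mulr_suml; apply: eq_bigr => o _.
rewrite /optimal_attacker; case: (boolP (optimal_guess (sweets w) o)) => [ho|_].
  by rewrite (optimal_guess_value i ho).
by rewrite !mul0r.
Qed.

(** * Independence of the users and resampling of one list *)

Lemma integral_constant (y : R) : (\int[Pr]_w y%:E)%E = y%:E.
Proof.
rewrite (eq_integral (cst y%:E)) // integral_cst // -[RHS]mule1; congr (_ * _)%E.
exact: probability_setT.
Qed.

(** The probability that the list of [u] lies in the box [S u], averaged over the position [m0] of
    its password. *)
Definition block_rate (S : 'I_U -> 'I_k -> set T) u : R :=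
  \sum_(m0 < k) (k%:R^-1 *
    \prod_(m < k) fine (if m == m0 then P (S u m) else Q (S u m))).

(** Summing [sweets_rectangle] over all positions gives a sum of products over users, which is a
    product of sums: the lists of different users are independent. *)
Lemma sweets_rectangle_prob (S : 'I_U -> 'I_k -> set T) :
  (forall u m, measurable (S u m)) ->
  Pr (sweets @^-1` rectangle S) = (\prod_u block_rate S u)%:E.
Proof.
move=> mS.
have mR : measurable (sweets @^-1` rectangle S).
  rewrite -[X in measurable X]setTI; apply: measurable_sweets => //.
  exact: measurable_rectangle.
have mI c : measurable (at_positions c `&` sweets @^-1` rectangle S).
  by apply: measurableI => //; exact: measurable_at_positions.
transitivity (\int[Pr]_w (\sum_(c : positions)
    (\1_(at_positions c `&` sweets @^-1` rectangle S) w)%:E))%E.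
  rewrite -[X in Pr X]setIT -integral_indic //; apply: eq_integral => w _.
  rewrite sumEFin; congr (_%:E); rewrite -[LHS]mul1r -[X in X * _ = _](sum_at_positions w).
  by rewrite mulr_suml; apply: eq_bigr => c _; rewrite indicI.
rewrite ge0_integral_sum //; last by move=> c; exact/measurable_EFinP/measurable_indic.
rewrite (eq_bigr (fun c : positions => (\prod_u (k%:R^-1 *
    \prod_m fine (if m == c u then P (S u m) else Q (S u m))))%:E)); last first.
  move=> c _; rewrite integral_indic // setIT big_split /= prodr_const card_ord.
  exact: sweets_rectangle.
by rewrite sumEFin -(bigA_distr_bigA (fun u m0 => k%:R^-1 *
    \prod_m fine (if m == m0 then P (S u m) else Q (S u m)))).
Qed.

Lemma block_rateT S u : (forall m, S u m = setT) -> block_rate S u = 1.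
Proof.
move=> hS; rewrite /block_rate (eq_bigr (fun=> k%:R^-1)) => [|m0 _].
  by rewrite sumr_const card_ord -[LHS]mulr_natl divff // pnatr_eq0 -lt0n.
rewrite big1 ?mulr1 // => m _.
by rewrite hS !probability_setT; case: ifP.
Qed.

Definition replace_block (x : data) u (y : data) : data :=
  fun v m => if v == u then y v m else x v m.

Lemma measurable_replace_block u : measurable_fun setT
  (fun z : Omega * Omega => replace_block (sweets z.1) u (sweets z.2)).
Proof.
apply: measurable_data => v m; rewrite /replace_block; case: (v == u).
  apply: (measurableT_comp (f := fun w => sweets w v m)); last exact: measurable_snd.
  by apply: (measurableT_comp (measurable_coord v m)); exact: measurable_sweets.
apply: (measurableT_comp (f := fun w => sweets w v m)); last exact: measurable_fst.
by apply: (measurableT_comp (measurable_coord v m)); exact: measurable_sweets.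
Qed.

(** Replacing the list of [u] by one from an independent copy preserves the law of the data, because
    rectangle probabilities are products over users. *)
Lemma integral_resample u f : measurable_fun setT f -> (forall x, 0 <= f x) ->
  (\int[Pr]_w (f (sweets w))%:E)%E =
  (\int[Pr]_w' \int[Pr]_w (f (replace_block (sweets w) u (sweets w')))%:E)%E.
Proof.
move=> mf f0.
have mfz : measurable_fun setT (fun z : Omega * Omega =>
    (f (replace_block (sweets z.1) u (sweets z.2)))%:E).
  apply/measurable_EFinP/measurableT_comp => //; exact: measurable_replace_block.
transitivity (\int[Pr \x Pr]_z
    (f (replace_block (sweets z.1) u (sweets z.2)))%:E)%E; last first.
  rewrite (fubini_tonelli2 (m1 := Pr) (m2 := Pr) _ mfz) // => z.
  by rewrite lee_fin.
transitivity (\int[Pr]_w (cst 1 w * f (sweets w))%:E)%E.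
  by apply: eq_integral => w _; rewrite mul1r.
transitivity (\int[Pr \x Pr]_z
    (cst 1 z * f (replace_block (sweets z.1) u (sweets z.2)))%:E)%E; last first.
  by apply: eq_integral => w _; rewrite mul1r.
apply: (@transfer_integral_pi _ _ _ _ _ data R Pr (Pr \x Pr)%E (cst 1) (cst 1)
  sweets (fun z => replace_block (sweets z.1) u (sweets z.2))
  _ _ _ _ _ _ (@rectangles d T U k)) => //.
- exact: measurable_sweets.
- exact: measurable_replace_block.
- exact: measurable_rectangles.
- exact: setI_closed_rectangles.
- exact: rectanglesT.
- by rewrite integral_constant ltry.
move=> _ [S mS ->].
have mR S' : (forall v m, measurable (S' v m)) -> measurable (sweets @^-1` rectangle S').
  move=> mS'; rewrite -[X in measurable X]setTI; apply: measurable_sweets => //.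
  exact: measurable_rectangle.
(* The constraint is divided between the copies: [S1] restricts the users other than [u] in the
   first, [S2] the user [u] in the second. *)
pose S1 v m := if v == u then setT else S v m.
pose S2 v m := if v == u then S v m else setT.
have mS1 v m : measurable (S1 v m) by rewrite /S1; case: ifP.
have mS2 v m : measurable (S2 v m) by rewrite /S2; case: ifP.
transitivity (Pr (sweets @^-1` rectangle S)).
  rewrite -[X in Pr X]setIT -integral_indic //; last exact: mR.
  by apply: eq_integral => w _; rewrite mul1r.
transitivity ((Pr \x Pr)%E
   ((sweets @^-1` rectangle S1) `*` (sweets @^-1` rectangle S2))); last first.
  rewrite -[X in (_ \x _)%E X]setIT -integral_indic //; last first.
    by apply: measurableX; exact: mR.
  apply: eq_integral => z _; rewrite mul1r !indicE; congr ((nat_of_bool _)%:R%:E).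
  apply/idP/idP => /set_mem /=; last first.
    move=> hz; apply/mem_set; split => v m; rewrite ?/S1 ?/S2; case: ifP => // vu.
      by have := hz v m; rewrite /replace_block vu.
    by have := hz v m; rewrite /replace_block vu.
  move=> [h1 h2]; apply/mem_set => v m; have := h1 v m; have := h2 v m.
  by rewrite /S1 /S2 /replace_block; case: ifP.
rewrite product_measure1E; [|exact: mR|exact: mR].
transitivity ((\prod_v block_rate S1 v)%:E * (\prod_v block_rate S2 v)%:E)%E;
  last by congr (_ * _)%E; apply/esym; exact: sweets_rectangle_prob.
rewrite sweets_rectangle_prob // -EFinM; congr (_%:E).
rewrite -big_split /=; apply: eq_bigr => v _.
have [vu|vu] := eqVneq v u.
  rewrite [X in X * _]block_rateT ?mul1r => [|m]; last by rewrite /S1 vu eqxx.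
  by apply: eq_bigr => m0 _; congr (_ * _); apply: eq_bigr => m _; rewrite /S2 vu eqxx.
rewrite [X in _ * X]block_rateT ?mulr1 => [|m]; last by rewrite /S2 (negbTE vu).
by apply: eq_bigr => m0 _; congr (_ * _); apply: eq_bigr => m _; rewrite /S1 (negbTE vu).
Qed.

(** The last two hypotheses say that [psi] depends only on the list of [u] and [phi] only on the
    others; after resampling, the double integral factors. *)
Lemma integral_indep_block u (psi phi : data -> R) :
  measurable_fun setT psi -> (forall x, 0 <= psi x) ->
  measurable_fun setT phi -> (forall x, 0 <= phi x) ->
  (forall x y, psi (replace_block x u y) = psi y) ->
  (forall x y, phi (replace_block x u y) = phi x) ->
  (\int[Pr]_w (psi (sweets w) * phi (sweets w))%:E)%E =
  ((\int[Pr]_w (psi (sweets w))%:E) * (\int[Pr]_w (phi (sweets w))%:E))%E.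
Proof.
move=> mpsi psi0 mphi phi0 hpsi hphi.
rewrite (integral_resample u (f := fun x => psi x * phi x)); last 2 first.
- exact: measurable_funM.
- by move=> x; rewrite mulr_ge0.
have mS (g : data -> R) : measurable_fun setT g -> measurable_fun setT (fun w => (g (sweets w))%:E).
  by move=> mg; apply/measurable_EFinP/measurableT_comp => //; exact: measurable_sweets.
rewrite -ge0_integralZr //; last 3 first.
- exact: mS.
- by move=> w _; rewrite lee_fin.
- by apply: integral_ge0 => w _; rewrite lee_fin.
apply: eq_integral => w' _; rewrite -ge0_integralZl //; last 3 first.
- exact: mS.
- by move=> w _; rewrite lee_fin.
- by rewrite lee_fin.
by apply: eq_integral => w _; rewrite hpsi hphi EFinM.
Qed.

(** As [few_failures] is affine in each probability and the variables [G v] are independent, each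
    can be replaced by its mean; one user is split off at a time. *)
Lemma integral_few_failures t (s : seq 'I_U) (G : 'I_U -> data -> R) (e : 'I_U -> R) :
  uniq s -> (forall v, measurable_fun setT (G v)) ->
  (forall v x, is_prob (G v x)) ->
  (forall v x y, G v (replace_block x v y) = G v y) ->
  (forall u v x y, v != u -> G v (replace_block x u y) = G v x) ->
  (forall v, v \in s -> (\int[Pr]_w (G v (sweets w))%:E)%E = (e v)%:E) ->
  (\int[Pr]_w (few_failures t [seq G v (sweets w) | v <- s])%:E)%E =
  (few_failures t [seq e v | v <- s])%:E.
Proof.
move=> us mG hG Gself Gother; elim: s t us => [|u s IH] t us he.
  by rewrite integral_constant.
case: t => [|t] /=; first by rewrite integral0.
move: us => /= /andP[uns us].
have hes v : v \in s -> (\int[Pr]_w (G v (sweets w))%:E)%E = (e v)%:E.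
  by move=> vs; apply: he; rewrite inE vs orbT.
have mF t' : measurable_fun setT (fun x => few_failures t' [seq G v x | v <- s]).
  exact: measurable_few_failures.
have F0 t' x : 0 <= few_failures t' [seq G v x | v <- s].
  suff /(few_failures_01 t')/andP[] : all is_prob [seq G v x | v <- s] by [].
  by rewrite all_map; apply/allP => v _; exact: hG.
have G0 x : 0 <= G u x by have /andP[] := hG u x.
have G1 x : 0 <= 1 - G u x by rewrite subr_ge0; have /andP[] := hG u x.
have mG1 : measurable_fun setT (fun x => 1 - G u x).
  by apply: measurable_funB => //; exact: measurable_cst.
have Fother t' x y : few_failures t' [seq G v (replace_block x u y) | v <- s] =
    few_failures t' [seq G v x | v <- s].
  congr (few_failures t' _); apply/eq_in_map => v vs; apply: Gother.
  by apply: contraNneq uns => <-.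
have mS (g : data -> R) : measurable_fun setT g -> measurable_fun setT (fun w => (g (sweets w))%:E).
  by move=> mg; apply/measurable_EFinP/measurableT_comp => //; exact: measurable_sweets.
have eu : (\int[Pr]_w (G u (sweets w))%:E)%E = (e u)%:E by apply: he; rewrite mem_head.
have e1 : (\int[Pr]_w (1 - G u (sweets w))%:E)%E = (1 - e u)%:E.
  have : ((\int[Pr]_w (G u (sweets w))%:E) + (\int[Pr]_w (1 - G u (sweets w))%:E))%E = 1%E.
    rewrite -ge0_integralD //.
    - rewrite -(integral_constant 1); apply: eq_integral => w _.
      by rewrite -EFinD addrC subrK.
    - by move=> w _; rewrite lee_fin.
    - exact: mS.
    - by move=> w _; rewrite lee_fin.
    - exact: (mS _ mG1).
  (* The total is 1, so the integral is finite and the subtraction is legitimate. *)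
  rewrite eu; case: (\int[_]_w _)%E => [y| |] //=; rewrite -EFinD => -[<-].
  by rewrite addrAC subrr add0r.
transitivity (\int[Pr]_w (
    (G u (sweets w) * few_failures t.+1 [seq G v (sweets w) | v <- s])%:E +
    ((1 - G u (sweets w)) * few_failures t [seq G v (sweets w) | v <- s])%:E))%E.
  by apply: eq_integral => w _; rewrite -EFinD.
rewrite ge0_integralD //; last 4 first.
- by move=> w _; rewrite lee_fin mulr_ge0.
- exact: (mS _ (measurable_funM (mG u) (mF t.+1))).
- by move=> w _; rewrite lee_fin mulr_ge0.
- exact: (mS _ (measurable_funM mG1 (mF t))).
rewrite (integral_indep_block (u := u) (psi := G u)
  (phi := fun x => few_failures t.+1 [seq G v x | v <- s])) //.
rewrite (integral_indep_block (u := u) (psi := fun x => 1 - G u x)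
  (phi := fun x => few_failures t [seq G v x | v <- s])) //; last first.
  by move=> x y; rewrite Gself.
by rewrite eu e1 !IH.
Qed.

(** * Integration against the density of [w], and the closed formula *)

Section density.
Variable a : R -> R.
Hypotheses (a0 : forall t, 0 <= a t) (ma : measurable_fun setT a)
  (weight_law : forall u (B : set R), measurable B ->
    Pr ((fun w => wval r (sweet real hon pos w u)) @^-1` B) =
    (\int[lebesgue_measure]_(x in B) (a x)%:E)%E).

Lemma measurable_weight u : measurable_fun setT (fun w => weight (sweets w) u).
Proof.
by apply: (measurableT_comp (measurable_wval mr r0 u)); exact: measurable_sweets.
Qed.

Lemma integral_weight u (phi : R -> R) :
  measurable_fun setT phi -> (forall y, 0 <= phi y) ->
  (\int[Pr]_w (phi (weight (sweets w) u))%:E)%E =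
  (\int[lebesgue_measure]_y (a y * phi y)%:E)%E.
Proof.
move=> mphi phi0.
transitivity (\int[Pr]_w (cst 1 w * phi (weight (sweets w) u))%:E)%E.
  by apply: eq_integral => w _; rewrite mul1r.
apply: (@transfer_integral _ _ _ _ _ _ R Pr lebesgue_measure (cst 1) a
  (fun w => weight (sweets w) u) id) => //.
  exact: measurable_weight.
move=> S mS.
transitivity (Pr ((fun w => weight (sweets w) u) @^-1` S)).
  rewrite -[X in Pr X]setIT -integral_indic //.
    by apply: eq_integral => w _; rewrite mul1r.
  by rewrite -[X in measurable X]setTI; exact: measurable_weight.
rewrite [LHS]weight_law // [LHS]integral_mkcond epatch_indic.
by apply: eq_integral => y _; rewrite EFinM.
Qed.

Lemma integral_value_before u v (t : R) : is_prob t ->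
  (\int[Pr]_w (value_before u v t (weight (sweets w) v))%:E)%E = (Ev a t)%:E.
Proof.
move=> /andP[t0 t1].
have pw w : is_prob (weight (sweets w) v) by exact: wval_is_prob.
have mvb : measurable_fun setT (value_before u v t).
  by apply: measurable_value_before => //; exact: measurable_cst.
pose F y := a y * value_before u v t y.
have vb0 y : 0 <= y -> 0 <= value_before u v t y.
  by rewrite /value_before; case: ifP.
have F0 y : 0 <= y -> 0 <= F y by move=> y0; rewrite mulr_ge0 ?vb0.
have mF : measurable_fun setT F by exact: measurable_funM.
have intE : (\int[Pr]_w (value_before u v t (weight (sweets w) v))%:E)%E =
    ((\int[lebesgue_measure]_(x in [set x : R | (0 <= x < t)%R]) (a x)%:E) +
     (\int[lebesgue_measure]_(x in `[t, 1%R]%classic) (x * a x)%:E))%E.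
  (* The indicator is 1 at every value of the weight. It keeps the integrand nonnegative on the
     whole line and limits the Lebesgue integral to the unit interval. *)
  transitivity (\int[Pr]_w (\1_(`[0%R, 1%R]%classic) (weight (sweets w) v) *
      value_before u v t (weight (sweets w) v))%:E)%E.
    apply: eq_integral => w _; rewrite indicE mem_set ?mul1r //=.
    by rewrite in_itv /=; exact: pw.
  rewrite (integral_weight v (phi := fun y => \1_(`[0%R, 1%R]%classic) y *
      value_before u v t y)); last 2 first.
  - by apply: measurable_funM => //; exact: measurable_indic.
  - move=> y; rewrite indicE; case: (boolP (y \in _)); rewrite ?mul0r // mul1r.
    by move=> /set_mem /=; rewrite in_itv /= => /andP[y0 _]; exact: vb0.
  transitivity (\int[lebesgue_measure]_(y in `[0%R, 1%R]%classic) (F y)%:E)%E.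
    rewrite [RHS]integral_mkcond epatch_indic; apply: eq_integral => y _ /=.
    by rewrite -EFinM; congr (_%:E); rewrite /F; ring.
  have -> : `[0, 1]%classic = `[0, t[%classic `|` `[t, 1]%classic :> set R.
    by rewrite -itv_bndbnd_setU // bnd_simp.
  rewrite ge0_integral_setU //=; last 3 first.
  - by apply: measurable_funTS; exact/measurable_EFinP.
  - move=> y [|]; rewrite /= in_itv /= lee_fin => /andP[hy _]; apply: F0 => //.
    exact: le_trans hy.
  - apply/disj_setPS => y [] /=; rewrite !in_itv /= => /andP[_ yt] /andP[ty _].
    by move: (lt_le_trans yt ty); rewrite ltxx.
  congr (_ + _)%E.
    have -> : [set x : R | 0 <= x < t] = `[0, t[%classic.
      by apply/seteqP; split => y /=; rewrite in_itv.
    apply: eq_integral => y /set_mem /=; rewrite in_itv /= => /andP[_ yt].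
    by rewrite /F /value_before ltNge ltW //= lt_eqF // mulr1.
  (* Opening the interval at [t] discards the tie [y = t], a null set on which the value depends on
     the user indices. *)
  rewrite -integral_itv_obnd_cbnd; last first.
    by apply: measurable_funTS; exact/measurable_EFinP.
  rewrite -integral_itv_obnd_cbnd; last first.
    apply: measurable_funTS; apply/measurable_EFinP; apply: measurable_funM => //.
  apply: eq_integral => y /set_mem /=; rewrite in_itv /= => /andP[ty _].
  by rewrite /F /value_before ty /= mulrC.
(* The integral is at most 1, so [fine] in [Ev] loses nothing. *)
rewrite /Ev -intE fineK // ge0_fin_numE; last first.
  by apply: integral_ge0 => w _; rewrite lee_fin; have /andP[] := value_before_is_prob u v t (pw w).
apply: (@le_lt_trans _ _ 1%E); last exact: ltry.
rewrite -[leRHS](integral_constant 1); apply: ge0_le_integral => //.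
- by move=> w _; rewrite lee_fin; have /andP[] := value_before_is_prob u v t (pw w).
- by apply/measurable_EFinP/measurableT_comp => //; exact: measurable_weight.
- by move=> w _; rewrite lee_fin; have /andP[] := value_before_is_prob u v t (pw w).
Qed.

Lemma Ev_is_prob (u : 'I_U) (t : R) : is_prob t -> is_prob (Ev a t).
Proof.
move=> ht; rewrite /is_prob -!lee_fin -(integral_value_before u u ht).
have pw w : is_prob (value_before u u t (weight (sweets w) u)).
  by apply: value_before_is_prob; exact: wval_is_prob.
apply/andP; split.
  by apply: integral_ge0 => w _; rewrite lee_fin; have /andP[] := pw w.
rewrite -[leRHS](integral_constant 1); apply: ge0_le_integral => //.
- by move=> w _; rewrite lee_fin; have /andP[] := pw w.
- apply/measurable_EFinP; apply: measurable_value_before; first exact: measurable_cst.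
  exact: measurable_weight.
- by move=> w _; rewrite lee_fin; have /andP[] := pw w.
Qed.

(** Tonelli's theorem applied to the representation of [Ev a t] as an integral over [Pr]; that
    representation is available for [t] in the unit interval only, hence the indicator. *)
Lemma measurable_Ev (u : 'I_U) :
  measurable_fun setT (fun t : R => \1_(`[0%R, 1%R]%classic) t * Ev a t).
Proof.
have -> : (fun t : R => \1_(`[0%R, 1%R]%classic) t * Ev a t) =
    (fun t => \1_(`[0%R, 1%R]%classic) t *
      fine (\int[Pr]_w (value_before u u t (weight (sweets w) u))%:E)%E).
  apply/funext => t; rewrite indicE; case: (boolP (t \in _)); last by rewrite !mul0r.
  by move=> /set_mem /=; rewrite in_itv /= => /(integral_value_before u u) ->.
apply: measurable_funM; first exact: measurable_indic.
apply: measurableT_comp; first exact: fine_measurable.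
apply: (measurable_fun_fubini_tonelli_F (m2 := Pr)
  (fun z => (value_before u u z.1 (weight (sweets z.2) u))%:E)).
  apply/measurable_EFinP; apply: measurable_value_before; first exact: measurable_fst.
  by apply: (measurableT_comp (measurable_weight u)); exact: measurable_snd.
move=> z; rewrite lee_fin.
by have /andP[] := value_before_is_prob u u z.1 (wval_is_prob r0 (sweets z.2) u).
Qed.

Lemma integral_user_term i u :
  (\int[Pr]_w (weight (sweets w) u * few_failures i
     [seq value_before u v (weight (sweets w) u) (weight (sweets w) v)
        | v <- others u])%:E)%E =
  (\int[lebesgue_measure]_(t in `[(k%:R)^-1%R, 1%R]%classic)
     (t * a t * few_failures i (nseq U.-1 (Ev a t)))%:E)%E.
Proof.
(* Cutting [Ev] off outside the unit interval makes it a measurable probability on the whole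
   line. *)
pose E t := \1_(`[0%R, 1%R]%classic) t * Ev a t.
pose psi t := t * few_failures i (nseq U.-1 (E t)).
have EP t : is_prob (E t).
  rewrite /E indicE; case: (boolP (t \in _)) => [/set_mem /=|_].
    by rewrite in_itv /= mul1r; exact: Ev_is_prob.
  by rewrite mul0r /is_prob lexx ler01.
have EE t : is_prob t -> E t = Ev a t.
  by move=> ht; rewrite /E indicE mem_set ?mul1r //= in_itv.
have few0 t : 0 <= few_failures i (nseq U.-1 (E t)).
  suff /(few_failures_01 i)/andP[] : all is_prob (nseq U.-1 (E t)) by [].
  by rewrite all_nseq EP orbT.
have pw x v : is_prob (weight x v) by exact: wval_is_prob.
have mw v : measurable_fun setT (weight ^~ v : data -> R).
  exact: measurable_wval.
have mpsi : measurable_fun setT psi.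
  apply: measurable_funM => //.
  have -> : (fun t => few_failures i (nseq U.-1 (E t))) =
      (fun t => few_failures i [seq E t | _ <- iota 0 U.-1]).
    by apply/funext => t; rewrite map_cst_nseq size_iota.
  by apply: (@measurable_few_failures R _ _ _ i (iota 0 U.-1) (fun _ => E)) => _; exact: measurable_Ev.
transitivity (\int[Pr]_w (psi (weight (sweets w) u))%:E)%E.
  rewrite (integral_resample u (f := fun x => weight x u * few_failures i
     [seq value_before u v (weight x u) (weight x v) | v <- others u])); last 2 first.
  - apply: measurable_funM => //.
    apply: (@measurable_few_failures R _ data _ i (others u) (fun v x =>
      value_before u v (weight x u) (weight x v))) => v.
    exact: measurable_value_before.
  - move=> x; apply: mulr_ge0; first by have /andP[] := pw x u.
    set s := map _ _; suff /(few_failures_01 i)/andP[] : all is_prob s by [].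
    by rewrite all_map; apply/allP => v _ /=; apply: value_before_is_prob.
  apply: eq_integral => w' _; set t := weight (sweets w') u.
  have t01 : is_prob t by exact: pw.
  pose G v x := value_before u v t (weight x v).
  transitivity (\int[Pr]_w (t%:E * (few_failures i [seq G v (sweets w) | v <- others u])%:E))%E.
    apply: eq_integral => w _; rewrite -EFinM; congr (_%:E).
    have -> : weight (replace_block (sweets w) u (sweets w')) u = t.
      by congr (wval r _); apply/funext => m; rewrite /replace_block eqxx.
    congr (_ * few_failures i _); apply/eq_in_map => v.
    rewrite mem_filter => /andP[vu _]; congr (value_before u v t _).
    by congr (wval r _); apply/funext => m; rewrite /replace_block (negbTE vu).
  rewrite ge0_integralZl //; last 3 first.
  - apply/measurable_EFinP; apply: (measurableT_comp (f := fun x : data =>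
      few_failures i [seq G v x | v <- others u])); last exact: measurable_sweets.
    apply: measurable_few_failures => v; apply: measurable_value_before => //.
  - move=> w _; rewrite lee_fin.
    set s := map _ _; suff /(few_failures_01 i)/andP[] : all is_prob s by [].
    by rewrite all_map; apply/allP => v _ /=; apply: value_before_is_prob.
  - by rewrite lee_fin; have /andP[] := t01.
  rewrite (integral_few_failures i (G := G) (e := fun=> Ev a t)) //.
  - rewrite -EFinM /psi -/t EE //; congr ((_ * few_failures i _)%:E).
    by rewrite map_cst_nseq size_others.
  - by rewrite filter_uniq // enum_uniq.
  - by move=> v; apply: measurable_value_before => //.
  - by move=> v x; apply: value_before_is_prob.
  - move=> v x y; congr (value_before u v t (wval r _)); apply/funext => m.
    by rewrite /replace_block eqxx.
  - move=> u' v x y vu; congr (value_before u v t (wval r _)); apply/funext => m.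
    by rewrite /replace_block (negbTE vu).
  - by move=> v _; exact: integral_value_before.
pose I : set R := `[(k%:R)^-1, 1]%classic.
have mI : measurable I by exact: measurable_itv.
have Iprob t : I t -> is_prob t.
  rewrite /I /= in_itv /= => /andP[kt t1]; rewrite /is_prob t1 andbT.
  by apply: le_trans kt; rewrite invr_ge0.
(* The bound [1/k] on the weight needs a list of nonzero mass, so [integral_sweets] is applied to
   both sides before comparing them. *)
transitivity (\int[Pr]_w (\1_I (weight (sweets w) u) * psi (weight (sweets w) u))%:E)%E.
  rewrite (integral_sweets (f := fun x => psi (weight x u))); last 2 first.
  - exact: measurableT_comp.
  - by move=> x; rewrite mulr_ge0 //; have /andP[] := pw x u.
  rewrite (integral_sweets (f := fun x => \1_I (weight x u) * psi (weight x u))); last 2 first.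
  - apply: (measurableT_comp (f := fun t => \1_I t * psi t)) => //.
    by apply: measurable_funM => //; exact: measurable_indic.
  - by move=> x; rewrite mulr_ge0 // mulr_ge0 //; have /andP[] := pw x u.
  apply: eq_integral => w _; case: (boolP [forall u, _]) => [/forallP hw|_]; last first.
    by rewrite !mul0r.
  rewrite [X in _ = (_ * (X * _))%:E]indicE mem_set ?mul1r // /I /= in_itv /=.
  by rewrite wval_ge_invk //=; have /andP[] := pw (sweets w) u.
rewrite (integral_weight u (phi := fun t => \1_I t * psi t)); last 2 first.
- by apply: measurable_funM => //; exact: measurable_indic.
- move=> t; rewrite indicE; case: (boolP (t \in _)) => [/set_mem/Iprob/andP[t0 _]|_].
    by rewrite mul1r mulr_ge0.
  by rewrite mul0r.
rewrite [RHS]integral_mkcond epatch_indic; apply: eq_integral => t _ /=.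
rewrite -EFinM; congr (_%:E); rewrite -/I indicE.
case: (boolP (t \in _)) => [/set_mem/Iprob ht|_]; last by rewrite !(mul0r, mulr0).
by rewrite /psi EE // mul1r mulr1 mulrCA mulrA.
Qed.

Lemma integral_ranked_success i :
  (\int[Pr]_w (ranked_success i (weight (sweets w)))%:E)%E = lambda_formula a U k i.
Proof.
have w0 x u : 0 <= weight x u by have /andP[] := @wval_is_prob _ _ _ U k _ r0 x u.
have few0 x u : 0 <= few_failures i
    [seq value_before u v (weight x u) (weight x v) | v <- others u].
  set s := map _ _; suff /(few_failures_01 i)/andP[] : all is_prob s by [].
  rewrite all_map; apply/allP => v _ /=; apply: value_before_is_prob.
  exact: wval_is_prob.
transitivity (\int[Pr]_w (\sum_u (weight (sweets w) u * few_failures i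
     [seq value_before u v (weight (sweets w) u) (weight (sweets w) v)
        | v <- others u])%:E))%E.
  by apply: eq_integral => w _; rewrite sumEFin.
rewrite ge0_integral_sum //; last 2 first.
- move=> u; apply/measurable_EFinP; apply: (measurableT_comp (f := fun x : data =>
    weight x u * few_failures i
      [seq value_before u v (weight x u) (weight x v) | v <- others u]));
    last exact: measurable_sweets.
  apply: measurable_funM; first exact: measurable_wval.
  apply: (@measurable_few_failures R _ data _ i (others u) (fun v x =>
    value_before u v (weight x u) (weight x v))) => v.
  by apply: measurable_value_before; exact: measurable_wval.
- by move=> u w _; rewrite lee_fin mulr_ge0.
(* Without users both sides are 0. Otherwise some user [u0] is available to represent [Ev] as an
   expectation. *)
have [U0|U0] := posnP U.
  rewrite big1; first by rewrite /lambda_formula U0 mul0e.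
  by move=> [u uU]; exfalso; rewrite U0 in uU.
pose u0 : 'I_U := Ordinal U0.
have Iprob (t : R) : `[(k%:R)^-1, 1]%classic t -> is_prob t.
  rewrite /= in_itv /= => /andP[kt t1]; rewrite /is_prob t1 andbT.
  by apply: le_trans kt; rewrite invr_ge0.
rewrite (eq_bigr _ (fun u _ => integral_user_term i u)) sume_cst_ord.
rewrite /lambda_formula; congr (_ * _)%E.
(* The index [j] of the formula is one more than the number of failures counted by
   [few_failures_nseq]. *)
rewrite big_add1 /= big_mkord -ge0_integral_sum //.
- apply: eq_integral => t _; rewrite sumEFin few_failures_nseq mulr_sumr.
  congr (_%:E); apply: eq_bigr => j _.
  have -> : (U - j.+1 = U.-1 - j)%N by rewrite -subn1 -subnDA add1n.
  by rewrite !subn1 /= -!mulrA.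
- move=> j.
  apply: (@eq_measurable_fun _ _ _ _ _ (fun t : R => (t * a t * ('C(U - 1, j.+1 - 1))%:R *
      (\1_(`[0%R, 1%R]%classic) t * Ev a t) ^+ (U - j.+1) *
      (1 - \1_(`[0%R, 1%R]%classic) t * Ev a t) ^+ (j.+1 - 1))%:E)).
    move=> t /set_mem /Iprob ht; have t01 : `[0%R, 1%R]%classic t by rewrite /= in_itv.
    by rewrite indicE mem_set // mul1r.
  apply: measurable_funTS; apply/measurable_EFinP.
  apply: measurable_funM; first apply: measurable_funM; first apply: measurable_funM.
  - exact: measurable_funM.
  - exact: measurable_cst.
  - by apply: measurable_funX; exact: (measurable_Ev u0).
  - apply: measurable_funX; apply: measurable_funB; first exact: measurable_cst.
    exact: (measurable_Ev u0).
- move=> j t /Iprob ht; have /andP[E0 E1] := Ev_is_prob u0 ht.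
  have /andP[t0 _] := ht.
  by rewrite lee_fin !mulr_ge0 // exprn_ge0 // subr_ge0.
Qed.

End density.

End model.

Unset Implicit Arguments.

Theorem theorem4 (R : realType)
  (d : measure_display) (T : measurableType d)   (* password space *)
  (P Q : probability T R)                        (* password / honeyword distributions *)
  (r : T -> R)                                   (* r = P/Q *)
  (k U : nat)
  (dO : measure_display) (Omega : measurableType dO) (Pr : probability Omega R)
  (real : 'I_U -> Omega -> T)                    (* real password of user u *)
  (hon : 'I_U -> 'I_k -> Omega -> T)             (* honeywords of user u *)
  (pos : 'I_U -> Omega -> 'I_k)                  (* position of the real password *)
  (a : R -> R)                                   (* density of w *)
  (i : nat) :
  (0 < k)%N ->
  (* r is the ratio P/Q (Radon-Nikodym derivative dP/dQ) *)
  measurable_fun setT r -> (forall x, 0 <= r x) ->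
  (forall S, measurable S -> P S = (\int[Q]_(x in S) (r x)%:E)%E) ->
  (* the random variables *)
  (forall u, measurable_fun setT (real u)) ->
  (forall u m, measurable_fun setT (hon u m)) ->
  (forall u c, measurable (pos u @^-1` [set c])) ->
  (* independent generation: real passwords ~ P, honeywords ~ Q i.i.d.,
     positions uniform on 'I_k, all mutually independent *)
  (forall (SA : 'I_U -> set T) (SB : 'I_U -> 'I_k -> set T) (c : 'I_U -> 'I_k),
      (forall u, measurable (SA u)) -> (forall u m, measurable (SB u m)) ->
      Pr (\bigcap_(u in setT)
            (real u @^-1` SA u `&` pos u @^-1` [set c u]
             `&` \bigcap_(m in setT) hon u m @^-1` SB u m))
      = (\prod_(u < U) (P (SA u) * ((k%:R)^-1)%:E * \prod_(m < k) Q (SB u m)))%E) ->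
  (* w has probability density a *)
  (forall t, 0 <= a t) -> measurable_fun setT a ->
  (forall u (B : set R), measurable B ->
      Pr ((fun w => wval r (sweet real hon pos w u)) @^-1` B)
      = (\int[lebesgue_measure]_(x in B) (a x)%:E)%E) ->
  (* lambda_U(i) = max over attackers of the expected game output *)
  (exists A, attacker A /\
     expected_success Pr real hon pos A i = lambda_formula a U k i) /\
  (forall A, attacker A ->
     (expected_success Pr real hon pos A i <= lambda_formula a U k i)%E).
Proof.
move=> k0 mr r0 rE mreal mhon mpos indep a0 ma weight_law.
rewrite -(integral_ranked_success k0 mr r0 rE mreal mhon mpos indep a0 ma weight_law).
split; last first.
  by move=> A; exact: (expected_success_le mr r0 rE mreal mhon mpos indep).
exists (@optimal_attacker _ _ _ r _ _); split.
  exact: (optimal_attackerP _ k0 mr r0).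
exact: (expected_success_optimal k0 mr r0 rE mreal mhon mpos indep).
Qed.
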